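(* Let $(A,\wedge,\mathfrak d)$ be a differential graded algebra with a Euclidean or Hermitian metric $\langle\cdot,\cdot\rangle$, such that $\mathfrak d$ has a formal adjoint $\mathfrak d^*$ and $A$ has a Hodge decomposition $$A=\mathcal H\oplus\operatorname{Im}\mathfrak d\oplus\operatorname{Im}\mathfrak d^*.$$ Then there is a canonical $A_\infty$ structure on the cohomology $H(A,\mathfrak d)$ with $m_2$ the product on $H(A,\mathfrak d)$ induced by $\wedge$.
   Context: A differential graded algebra $(A,\wedge,\mathfrak d)$ is a $\mathbb Z$-graded vector space $A=\bigoplus_n A^n$ with an associative graded product $\wedge$ and a differential $\mathfrak d$ of degree $1$ ($\mathfrak d^2=0$) that is a graded derivation of $\wedge$; $H(A,\mathfrak d)=\operatorname{Ker}\mathfrak d/\operatorname{Im}\mathfrak d$. A formal adjoint of $\mathfrak d$ is a linear operator $\mathfrak d^*:A\to A$ with $\langle\mathfrak d a,b\rangle=\langle a,\mathfrak d^*b\rangle$ for all $a,b\in A$. Here $\mathcal H=\operatorname{Ker}\square_{\mathfrak d}$ with $\square_{\mathfrak d}=\mathfrak d\mathfrak d^*+\mathfrak d^*\mathfrak d$. An $A_\infty$ structure (in the sense of Stasheff) on a $\mathbb Z$-graded vector space $B$ is a sequence of linear maps $m_k:B^{\otimes k}\to B$, $k\ge1$, with $\deg m_k=2-k$, satisfying the sequence of higher associativity identities. The first of these say that $m_1^2=0$, that $m_1(m_2(a_1\otimes a_2))=m_2(m_1(a_1)\otimes a_2)+(-1)^{|a_1|}m_2(a_1\otimes m_1(a_2))$,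 and that $m_2$ is associative up to a homotopy given by $m_3$ with respect to the differential $m_1$. In particular, if $m_1=0$ then $m_2$ is associative. The word ''canonical'' is used informally, without a formal definition. *)

(* Defs.v *)
From HB Require Import structures.
From mathcomp Require Import all_boot all_order all_algebra.
From mathcomp Require Import sesquilinear ring_quotient generic_quotient.
From mathcomp Require Import complex.
From mathcomp Require Import boolp classical_sets reals.

Set Implicit Arguments.
Unset Strict Implicit.
Unset Printing Implicit Defensive.

Import Order.TTheory GRing.Theory Num.Theory.
Local Open Scope ring_scope.
Local Open Scope quotient_scope.

Definition is_submodule (K : fieldType) (V : lmodType K) (W : set V) : Prop :=
  W 0 /\ forall (a : K) (x y : V), W x -> W y -> W (a *: x + y).

Definition is_direct_sum (K : fieldType) (V : lmodType K) (W : int -> set V) :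
    Prop :=
  (forall x : V, exists (s : seq int) (c : int -> V),
      [/\ uniq s, forall n, W n (c n) & x = \sum_(n <- s) c n]) /\
  (forall (s : seq int) (c : int -> V),
      uniq s -> (forall n, W n (c n)) -> \sum_(n <- s) c n = 0 ->
      forall n, n \in s -> c n = 0).

Record graded_space (K : fieldType) := GradedSpace {
  gspace :> lmodType K;
  gdeg : int -> set gspace;
  gdeg_submodule : forall n, is_submodule (gdeg n);
  gdeg_direct : is_direct_sum gdeg
}.

Record dga (K : fieldType) := DGA {
  dga_space :> graded_space K;
  wedge : {bilinear dga_space -> dga_space -> dga_space};
  dif : {linear dga_space -> dga_space};
  wedgeA : forall a b c, wedge a (wedge b c) = wedge (wedge a b) c;
  wedge_deg : forall m n a b,
    gdeg m a -> gdeg n b -> gdeg (m + n) (wedge a b);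
  dif_deg : forall n a, gdeg n a -> gdeg (n + 1) (dif a);
  dif_dif : forall a, dif (dif a) = 0;
  dif_wedge : forall n a b, gdeg n a ->
    dif (wedge a b) = wedge (dif a) b + (-1) ^ n *: wedge a (dif b)
}.

Arguments wedge {K} A : rename.
Arguments dif {K} A : rename.

Section Cohomology.
Variables (K : fieldType) (A : dga K).
Local Notation d := (dif A).

Definition closed_pred : {pred A} := fun x => d x == 0.

Fact closed_submod : submod_closed closed_pred.
Proof.
split=> [|a x y /eqP dx /eqP dy]; first by rewrite unfold_in linear0.
by rewrite unfold_in linearP dx dy scaler0 addr0.
Qed.
HB.instance Definition _ :=
  GRing.isSubmodClosed.Build K A closed_pred closed_submod.

Record cocycle := Cocycle { cocycle_val : A; _ : cocycle_val \in closed_pred }.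
HB.instance Definition _ := [isSub for cocycle_val].
HB.instance Definition _ := [Choice of cocycle by <:].
HB.instance Definition _ := [SubChoice_isSubLmodule of cocycle by <:].

Definition exact_pred : {pred cocycle} := fun z => `[< exists b, val z = d b >].

Fact exact_zmod : zmod_closed exact_pred.
Proof.
split=> [|x y /asboolP[b xb] /asboolP[c yc]]; apply/asboolP.
  by exists 0; rewrite [RHS]linear0 raddf0.
by exists (b - c); rewrite [RHS]linearB -xb -yc raddfB.
Qed.
HB.instance Definition _ := GRing.isZmodClosed.Build cocycle exact_pred exact_zmod.

Definition coh := Quotient.quot exact_pred.
HB.instance Definition _ := GRing.Zmodule.on coh.

Lemma coh_eqP (x y : cocycle) :
  reflect (exists b, val x - val y = d b) (\pi_coh x == \pi_coh y).
Proof.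
rewrite -Quotient.idealrBE; apply: (iffP (asboolP _)) => -[b xyb]; exists b.
  by rewrite -xyb raddfB.
by rewrite -xyb raddfB.
Qed.

Definition coh_scale (a : K) (u : coh) : coh := \pi_coh (a *: repr u).

Lemma coh_scaleE (a : K) (x : cocycle) :
  coh_scale a (\pi_coh x) = \pi_coh (a *: x).
Proof.
apply/eqP/coh_eqP; have /eqP/coh_eqP[b xb] := reprK (\pi_coh x).
by exists (a *: b); rewrite [RHS]linearZ /= -xb scalerBr.
Qed.

Lemma coh_surj (u : coh) : exists x : cocycle, u = \pi_coh x.
Proof. by exists (repr u); rewrite reprK. Qed.

Fact coh_scaleA (a b : K) (u : coh) :
  coh_scale a (coh_scale b u) = coh_scale (a * b) u.
Proof. by have [x ->] := coh_surj u; rewrite !coh_scaleE scalerA. Qed.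

Fact coh_scale1 : left_id 1 coh_scale.
Proof. by move=> u; have [x ->] := coh_surj u; rewrite coh_scaleE scale1r. Qed.

Fact coh_scaleDr : right_distributive coh_scale +%R.
Proof.
move=> a u v; have [x ->] := coh_surj u; have [y ->] := coh_surj v.
by rewrite -raddfD !coh_scaleE scalerDr raddfD.
Qed.

Fact coh_scaleDl (u : coh) : {morph coh_scale^~ u : a b / a + b}.
Proof.
by move=> a b; have [x ->] := coh_surj u; rewrite !coh_scaleE scalerDl raddfD.
Qed.

HB.instance Definition _ := GRing.Zmodule_isLmodule.Build K coh
  coh_scaleA coh_scale1 coh_scaleDr coh_scaleDl.

(* The class [x] of a closed x; the value is junk (namely 0) otherwise. *)
Definition coh_class (x : A) : coh := \pi_coh (insubd (0 : cocycle) x).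
Definition coh_repr (u : coh) : A := val (repr u).

Lemma coh_repr_closed u : d (coh_repr u) = 0.
Proof. exact/eqP/(valP (repr u)). Qed.

Lemma coh_reprK u : coh_class (coh_repr u) = u.
Proof. by rewrite /coh_class /coh_repr valKd reprK. Qed.

Lemma coh_class_eq x y : d x = 0 -> d y = 0 ->
  (coh_class x = coh_class y) <-> exists b, x - y = d b.
Proof.
move=> /eqP dx /eqP dy; rewrite (rwP eqP) -(rwP (coh_eqP _ _)).
by rewrite !insubdK.
Qed.

Lemma coh_repr_class x : d x = 0 -> exists b, coh_repr (coh_class x) - x = d b.
Proof.
by move=> dx; apply/(coh_class_eq (coh_repr_closed _) dx); rewrite coh_reprK.
Qed.

Lemma coh_classP a x y : d x = 0 -> d y = 0 ->
  coh_class (a *: x + y) = a *: coh_class x + coh_class y.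
Proof.
move=> /eqP dx /eqP dy.
have sc (z : cocycle) : a *: (\pi_coh z : coh) = \pi_coh (a *: z).
  exact: coh_scaleE.
rewrite /coh_class sc -raddfD; congr (\pi_coh _); apply: val_inj.
have cxy : a *: x + y \in closed_pred by apply: closed_submod.2.
by rewrite insubdK // [RHS]/= !insubdK.
Qed.

Lemma coh_class0 : coh_class 0 = 0.
Proof.
have := coh_classP 1 (linear0 d) (linear0 d).
by rewrite !scale1r addr0 => /(congr1 (fun u => u - coh_class 0)); rewrite subrr addrK.
Qed.

Lemma coh_class_sum (s : seq int) (c : int -> A) : (forall n, d (c n) = 0) ->
  coh_class (\sum_(n <- s) c n) = \sum_(n <- s) coh_class (c n).
Proof.
move=> dc; elim: s => [|n s IHs]; first by rewrite !big_nil coh_class0.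
rewrite !big_cons -IHs -[c n]scale1r coh_classP ?scale1r //.
by rewrite linear_sum big1.
Qed.

Lemma coh_class_exact x b : d x = 0 -> x = d b -> coh_class x = 0.
Proof.
move=> dx xb; rewrite -coh_class0; apply/(coh_class_eq dx (linear0 d)).
by exists b; rewrite subr0.
Qed.

Lemma closed_components (s : seq int) (c : int -> A) :
  uniq s -> (forall n, gdeg n (c n)) -> d (\sum_(n <- s) c n) = 0 ->
  forall n, n \in s -> d (c n) = 0.
Proof.
move=> us cn dc n ns; have [_ /(_ [seq m + 1 | m <- s])] := gdeg_direct A.
move=> /(_ (fun m => d (c (m - 1)))) ind; rewrite -[n](addrK 1).
apply: ind; last exact: map_f.
- by rewrite map_inj_uniq //; apply: addIr.
- by move=> m; rewrite -{1}[m](subrK 1); apply: dif_deg.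
by rewrite big_map -[RHS]dc linear_sum; apply: eq_bigr => m _; rewrite addrK.
Qed.

Lemma closed_decomp x : d x = 0 -> exists (s : seq int) (c : int -> A),
  [/\ uniq s, forall n, gdeg n (c n), forall n, d (c n) = 0
    & x = \sum_(n <- s) c n].
Proof.
have [s [c [us cn ->]]] := (gdeg_direct A).1 x; move=> dx.
exists s, (fun n => if n \in s then c n else 0); split=> //.
- by move=> n; case: ifP => // _; have [] := gdeg_submodule A n.
- move=> n; case: ifP => [ns|_]; last exact: linear0.
  exact: (closed_components us cn dx).
by apply: eq_big_seq => n ->.
Qed.

Definition coh_deg (n : int) : set coh :=
  [set u | exists x : A, [/\ d x = 0, gdeg n x & u = coh_class x]].

Fact coh_deg_submodule n : is_submodule (coh_deg n).
Proof.
have [g0 gP] := gdeg_submodule A n; split.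
  by exists 0; rewrite linear0 coh_class0.
move=> a _ _ [x [dx gx ->]] [y [dy gy ->]]; exists (a *: x + y).
by rewrite coh_classP // linearP dx dy scaler0 addr0; split=> //; apply: gP.
Qed.

Lemma big_widen_seq (s t : seq int) (c : int -> A) :
  uniq s -> uniq t -> {subset s <= t} ->
  \sum_(n <- t) (if n \in s then c n else 0) = \sum_(n <- s) c n.
Proof.
move=> us ut st; rewrite -big_mkcond -big_filter; apply: perm_big.
apply: uniq_perm; rewrite ?filter_uniq // => n.
by rewrite mem_filter; case: (boolP (n \in s)) => //= /st.
Qed.

Fact coh_deg_direct : is_direct_sum coh_deg.
Proof.
split=> [u|s C us /choice[x xP] C0 n ns].
  have [s [c [us cn dc uc]]] := closed_decomp (coh_repr_closed u).
  exists s, (fun n => coh_class (c n)); split=> //; first by move=> n; exists (c n).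
  by rewrite -coh_class_sum // -uc coh_reprK.
have [x0 dx] : (forall n, C n = coh_class (x n)) /\ forall n, d (x n) = 0.
  by split=> m; have [] := xP m.
have dsx : d (\sum_(m <- s) x m) = 0 by rewrite linear_sum big1.
have : coh_class (\sum_(m <- s) x m) = coh_class 0.
  by rewrite coh_class_sum // coh_class0 -[RHS]C0; apply: eq_bigr.
move=> /(coh_class_eq dsx (linear0 d))[b]; rewrite subr0 => sxb.
have [[t [c [ut ct bE]]] ind] := ((gdeg_direct A).1 b, (gdeg_direct A).2).
pose t1 := [seq m + 1 | m <- t]; pose r := undup (s ++ t1).
have ut1 : uniq t1 by rewrite map_inj_uniq //; apply: addIr.
pose e m := (if m \in s then x m else 0) -
  (if m \in t1 then d (c (m - 1)) else 0).
have em m : gdeg m (e m).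
  have [g0 gP] := gdeg_submodule A m; rewrite /e addrC -scaleN1r.
  apply: gP; case: ifP => // _; last by have [] := xP m.
  by rewrite -{1}[m](subrK 1); apply: dif_deg.
have e0 : \sum_(m <- r) e m = 0.
  rewrite big_split sumrN !big_widen_seq ?undup_uniq //=.
  - by rewrite big_map sxb bE linear_sum -sumrB big1 // => m _; rewrite addrK subrr.
  - by move=> m mt; rewrite mem_undup mem_cat mt orbT.
  - by move=> m ms; rewrite mem_undup mem_cat ms.
have /eqP : e n = 0.
  by apply: (ind _ _ (undup_uniq _) em e0); rewrite mem_undup mem_cat ns.
rewrite /e ns subr_eq0 x0 => /eqP; case: ifP => _ xn.
  exact: coh_class_exact xn.
by rewrite xn coh_class0.
Qed.

Definition cohomology : graded_space K :=
  GradedSpace coh_deg_submodule coh_deg_direct.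

Local Notation "a ^^ b" := (wedge A a b) (at level 40).

Lemma dif_wedge_closed x y : d y = 0 -> d (x ^^ y) = d x ^^ y.
Proof.
move=> dy; have [s [c [us cn ->]]] := (gdeg_direct A).1 x.
rewrite linear_sumlz !linear_sum linear_sumlz; apply: eq_bigr => n _.
by rewrite (dif_wedge _ (cn n)) dy linear0r scaler0 addr0.
Qed.

Lemma wedge_closed x y : d x = 0 -> d y = 0 -> d (x ^^ y) = 0.
Proof. by move=> dx dy; rewrite dif_wedge_closed // dx linear0l. Qed.

Lemma wedge_exactr x b : d x = 0 -> exists c, x ^^ d b = d c.
Proof.
move=> /closed_decomp[s [c [us cn dc ->]]].
exists (\sum_(n <- s) ((-1) ^ n)^-1 *: (c n ^^ b)).
rewrite linear_sumlz linear_sum; apply: eq_bigr => n _.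
rewrite linearZ /= (dif_wedge _ (cn n)) dc linear0l add0r scalerA.
by rewrite mulVf ?scale1r // expfz_neq0 // oppr_eq0 oner_eq0.
Qed.

Definition coh_mul (u v : coh) : coh := coh_class (coh_repr u ^^ coh_repr v).

Lemma coh_mulE x y : d x = 0 -> d y = 0 ->
  coh_mul (coh_class x) (coh_class y) = coh_class (x ^^ y).
Proof.
move=> dx dy; rewrite /coh_mul.
have [[b xb] [c yc]] := (coh_repr_class dx, coh_repr_class dy).
have [dX dY] := (coh_repr_closed (coh_class x), coh_repr_closed (coh_class y)).
apply/(coh_class_eq (wedge_closed dX dY) (wedge_closed dx dy)).
have [e xc] := wedge_exactr c dx; exists (b ^^ coh_repr (coh_class y) + e).
rewrite linearD -xc -yc dif_wedge_closed // -xb.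
by rewrite linearBl linearBr addrA subrK.
Qed.

End Cohomology.

Section AInfinity.
Variables (K : fieldType) (B : graded_space K).

(* A sequence of linear maps m_k : B^{(x) k} -> V, k >= 1, is encoded by a single
   function on lists: m_k is its restriction to the lists of length k, and is
   required to be k-linear. The value on the empty list carries no meaning. *)
Definition multilinear (V : lmodType K) (m : seq B -> V) : Prop :=
  forall (s1 s2 : seq B) (a : K) (x y : B),
    m (s1 ++ (a *: x + y) :: s2) = a *: m (s1 ++ x :: s2) + m (s1 ++ y :: s2).

Fixpoint homogeneous (e : seq int) (s : seq B) : Prop :=
  match e, s with
  | [::], [::] => True
  | n :: e', x :: s' => gdeg n x /\ homogeneous e' s'
  | _, _ => False
  end.

(* deg m_k = p - k *)
Definition has_degree (V : graded_space K) (p : int) (m : seq B -> V) : Prop :=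
  forall (e : seq int) (s : seq B), s != [::] -> homogeneous e s ->
    gdeg (\sum_(n <- e) n + (p - (size s)%:Z)) (m s).

(* The sum over r + l + t = k, l >= 1, of
     (-1)^(r + l t) f_{r+1+t} (1^{(x) r} (x) m_l (x) 1^{(x) t})
   on the tensor s of homogeneous elements of degrees e, k = size s; moving m_l,
   of degree 2 - l, past the first r factors gives the Koszul sign. *)
Definition insertion_sum (V : lmodType K) (f : seq B -> V) (m : seq B -> B)
    (e : seq int) (s : seq B) : V :=
  \sum_(r < size s) \sum_(1 <= l < (size s - r).+1)
    (-1) ^ ((r + l * (size s - r - l))%N%:Z
            + (2 - l%:Z) * \sum_(n <- take r e) n) *:
    f (take r s ++ m (take l (drop r s)) :: drop (r + l) s).

Record ainf_structure := AInf {
  ainf_op :> seq B -> B;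
  ainf_multilinear : multilinear ainf_op;
  ainf_degree : has_degree 2 ainf_op;
  ainf_stasheff : forall (e : seq int) (s : seq B),
    s != [::] -> homogeneous e s -> insertion_sum ainf_op ainf_op e s = 0
}.

(* An A-infinity morphism f from (B, m) to a differential graded algebra A,
   seen as the A-infinity algebra with operations d, wedge, 0, 0, ...  *)
Definition ainf_morphism (A : dga K) (m : ainf_structure) (f : seq B -> A) :
    Prop :=
  [/\ multilinear f, has_degree 1 f
    & forall (e : seq int) (s : seq B), s != [::] -> homogeneous e s ->
      insertion_sum f m e s =
      dif A (f s) +
      \sum_(1 <= k < size s)
        (-1) ^ (k.-1%:Z + (1 - (size s - k)%N%:Z) * \sum_(n <- take k e) n) *:
        wedge A (f (take k s)) (f (drop k s))].

End AInfinity.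

Section Hodge.
Variables (K : numFieldType) (theta : K -> K).

Definition hodge_decomposition (A : dga K) (ds : A -> A) : Prop :=
  let d := dif A in
  let harmonic h := d (ds h) + ds (d h) = 0 in
  (forall a, exists h b c, harmonic h /\ a = h + d b + ds c) /\
  (forall h b c, harmonic h -> h + d b + ds c = 0 ->
    [/\ h = 0, d b = 0 & ds c = 0]).

Record hodge_dga := HodgeDGA {
  hodge_space :> dga K;
  metric : {dot hodge_space for theta};
  codif : {linear hodge_space -> hodge_space};
  metric_adjoint : forall a b,
    metric (dif hodge_space a) b = metric a (codif b);
  hodge_decomp : hodge_decomposition codif
}.

Arguments metric A : rename.

Record hodge_iso (A B : hodge_dga) := HodgeIso {
  hodge_fun :> {linear A -> B};
  hodge_bij : bijective hodge_fun;
  hodge_fun_deg : forall n a, gdeg n a -> gdeg n (hodge_fun a);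
  hodge_fun_wedge : forall a b,
    hodge_fun (wedge A a b) = wedge B (hodge_fun a) (hodge_fun b);
  hodge_fun_dif : forall a, hodge_fun (dif A a) = dif B (hodge_fun a);
  hodge_fun_metric : forall a b,
    metric B (hodge_fun a) (hodge_fun b) = metric A a b
}.

Definition coh_map (A B : hodge_dga) (phi : hodge_iso A B) (u : coh A) : coh B :=
  coh_class (phi (coh_repr u)).

Lemma coh_mapE (A B : hodge_dga) (phi : hodge_iso A B) (x : A) :
  dif A x = 0 -> coh_map phi (coh_class x) = coh_class (phi x).
Proof.
move=> dx; have [b xb] := coh_repr_class dx.
have dphi y : dif A y = 0 -> dif B (phi y) = 0.
  by move=> dy; rewrite -hodge_fun_dif dy linear0.
apply/(coh_class_eq (dphi _ (coh_repr_closed _)) (dphi _ dx)).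
by exists (phi b); rewrite -hodge_fun_dif -xb linearB.
Qed.

(* A choice, for every A, of an A-infinity structure on H(A) is canonical when
   it depends only on the given data, i.e. commutes with all isometric
   isomorphisms of differential graded algebras, and when each structure is the
   one transferred from A: there is an A-infinity morphism f : H(A) -> A such
   that f_1 sends every class to one of its representatives (so that f is a
   quasi-isomorphism inducing the identity in cohomology). The second clause
   excludes the structure with m_k = 0 for all k <> 2. *)
Definition canonical
    (m : forall A : hodge_dga, ainf_structure (cohomology A)) : Prop :=
  (forall (A B : hodge_dga) (phi : hodge_iso A B) (s : seq (coh A)),
     s != [::] -> m B (map (coh_map phi) s) = coh_map phi (m A s)) /\
  (forall A : hodge_dga, exists f : seq (coh A) -> A,
     ainf_morphism (m A) f /\
     forall u, dif A (f [:: u]) = 0 /\ coh_class (f [:: u]) = u).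

End Hodge.

Inductive metric_kind := Euclidean | Hermitian.

Definition scalars (R : realType) (k : metric_kind) : numFieldType :=
  match k with Euclidean => R | Hermitian => R[i] end.

Definition scalar_conj (R : realType) (k : metric_kind) :
    scalars R k -> scalars R k :=
  match k with Euclidean => idfun | Hermitian => Num.conj end.

Arguments scalar_conj : clear implicits.

(* Main.v *)
(* Kadeishvili's construction. After a shift of degrees the operations b_k on
   H(A) and the components f_k : H(A)^k -> A of a morphism satisfy relations whose
   only signs are [koszul] = - (-1)^deg on each factor passed. Take a section i of the
   class map and a homotopy Q of degree -1 with d Q y = y for y exact. With
     U(s) = sum of f(u) f(v) over s = u v
            - sum of f(u, b(v), w) over s = u v w with 1 < |v| < |s|
   set b(s) = [U(s)] and f(s) = Q (i (b s) - U(s)). If the relations hold on lists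
   shorter than s then d U(s) = - i ((b o b)(s)). Passing to classes gives
   (b o b)(s) = 0; hence U(s) is closed and i (b s) - U(s) is exact, which is the
   morphism relation at s.
   The metric enters only through Q, built from the d^*-exact primitives of exact
   elements, so everything commutes with isometric isomorphisms. *)
From HB Require Import structures.
From mathcomp Require Import all_boot all_order all_algebra.
From mathcomp Require Import boolp reals zify ring.
Require Import Defs.

Set Implicit Arguments.
Unset Strict Implicit.
Unset Printing Implicit Defensive.

Import Order.TTheory GRing.Theory Num.Theory.
Local Open Scope ring_scope.

(** * Sums over deconcatenations *)

Section DeconcatenationSum.
Variable T : Type.

(** Recursion on the list instead of a sum over cut positions lets the coalgebra identities go by
    induction, without index arithmetic. Both pieces may be empty. [dsum_big] returns to indices
    where explicit signs are compared. *)
Fixpoint dsum (V : nmodType) (F : seq T -> seq T -> V) (s : seq T) : V :=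
  if s is x :: s' then F [::] s + dsum (fun u => F (x :: u)) s'
  else F [::] [::].

Lemma eq_dsum (V : nmodType) (F G : seq T -> seq T -> V) s :
  (forall u v, u ++ v = s -> F u v = G u v) -> dsum F s = dsum G s.
Proof.
elim: s F G => [|x s IHs] F G FG /=; first exact: FG.
by congr (_ + _); [apply: FG | apply: IHs => u v uvs; apply: FG; rewrite /= uvs].
Qed.

Lemma dsum0 (V : nmodType) (F : seq T -> seq T -> V) s :
  (forall u v, u ++ v = s -> F u v = 0) -> dsum F s = 0.
Proof.
move=> F0; rewrite (eq_dsum (G := fun _ _ => 0)) //.
by elim: s {F0} => //= x s ->; rewrite addr0.
Qed.

Lemma dsumD (V : nmodType) (F G : seq T -> seq T -> V) s :
  dsum (fun u v => F u v + G u v) s = dsum F s + dsum G s.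
Proof. by elim: s F G => //= x s IHs F G; rewrite IHs addrACA. Qed.

Lemma raddf_dsum (V W : nmodType) (h : {additive V -> W})
    (F : seq T -> seq T -> V) s :
  h (dsum F s) = dsum (fun u v => h (F u v)) s.
Proof. by elim: s F => //= x s IHs F; rewrite raddfD IHs. Qed.

Lemma dsumN (V : zmodType) (F : seq T -> seq T -> V) s :
  dsum (fun u v => - F u v) s = - dsum F s.
Proof. by elim: s F => //= x s IHs F; rewrite IHs opprD. Qed.

Lemma dsumZ (K : pzRingType) (V : lmodType K) a (F : seq T -> seq T -> V) s :
  dsum (fun u v => a *: F u v) s = a *: dsum F s.
Proof. by elim: s F => //= x s IHs F; rewrite IHs scalerDr. Qed.

Lemma dsum_cat_cons (V : nmodType) (F : seq T -> seq T -> V) p y q :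
  dsum F (p ++ y :: q) =
  dsum (fun u v => F u (v ++ y :: q)) p + dsum (fun u v => F (p ++ y :: u) v) q.
Proof. by elim: p F => //= x p IHp F; rewrite IHp addrA. Qed.

(** Coassociativity of deconcatenation: both sides run over the cuts of [s] into three pieces. *)
Lemma dsum_assoc (V : nmodType) (F : seq T -> seq T -> seq T -> V) s :
  dsum (fun x w => dsum (fun u v => F u v w) x) s =
  dsum (fun u x => dsum (F u) x) s.
Proof.
elim: s F => //= x s IHs F.
by rewrite dsumD (IHs (fun u => F (x :: u))) addrA.
Qed.

Lemma dsum_exchange (V : nmodType)
    (F : seq T -> seq T -> seq T -> seq T -> V) s t :
  dsum (fun u v => dsum (F u v) t) s =
  dsum (fun x y => dsum (fun u v => F u v x y) s) t.
Proof. by elim: s F => //= x s IHs F; rewrite IHs -dsumD. Qed.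

Lemma dsum_big (V : nmodType) (F : seq T -> seq T -> V) s :
  dsum F s = \sum_(k < (size s).+1) F (take k s) (drop k s).
Proof.
elim: s F => [|x s IHs] F /=; first by rewrite big_ord1.
by rewrite big_ord_recl /= IHs.
Qed.

End DeconcatenationSum.

Lemma dsum_map (T U : Type) (h : T -> U) (V : nmodType)
    (F : seq U -> seq U -> V) s :
  dsum F (map h s) = dsum (fun u v => F (map h u) (map h v)) s.
Proof. by elim: s F => //= x s IHs F; rewrite IHs. Qed.

(** * Multilinear functions on lists and insertion of an operation *)

Section Multilinear.
Variables (K : fieldType) (B : graded_space K) (V : lmodType K) (g : seq B -> V).
Hypothesis gl : multilinear g.

Lemma multilinearD u x y w :
  g (u ++ (x + y) :: w) = g (u ++ x :: w) + g (u ++ y :: w).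
Proof. by rewrite -[in LHS](scale1r x) gl scale1r. Qed.

Lemma multilinear0 u w : g (u ++ 0 :: w) = 0.
Proof.
by apply: (addrI (g (u ++ 0 :: w))); rewrite -multilinearD !addr0.
Qed.

Lemma multilinearZ u a x w : g (u ++ (a *: x) :: w) = a *: g (u ++ x :: w).
Proof. by rewrite -[a *: x]addr0 gl multilinear0 addr0. Qed.

Lemma multilinearN u x w : g (u ++ (- x) :: w) = - g (u ++ x :: w).
Proof. by rewrite -scaleN1r multilinearZ scaleN1r. Qed.

Lemma multilinear_dsum u (F : seq B -> seq B -> B) s w :
  g (u ++ dsum F s :: w) = dsum (fun x y => g (u ++ F x y :: w)) s.
Proof. by elim: s F => //= x s IHs F; rewrite multilinearD IHs. Qed.

End Multilinear.

Section Insertion.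
Variables (K : fieldType) (B : graded_space K) (sg : {linear B -> B}).

(* The coderivation of the tensor coalgebra with corestriction b, followed by g;
   sg is the Koszul sign of moving an operator of degree 1 past a factor. *)
Definition ins (V : nmodType) (b : seq B -> B) (g : seq B -> V) (s : seq B) : V :=
  dsum (fun u => dsum (fun v w => g (map sg u ++ b v :: w))) s.

Lemma insE (V : nmodType) b (g : seq B -> V) s :
  ins b g s = dsum (fun u => dsum (fun v w => g (map sg u ++ b v :: w))) s.
Proof. by []. Qed.

Lemma ins_multilinear (V : lmodType K) b (g : seq B -> V) :
  multilinear b -> multilinear g -> multilinear (ins b g).
Proof.
move=> bl gl s1 s2 a x y; rewrite /ins !dsum_cat_cons /=.
under eq_dsum => u v _ do rewrite dsum_cat_cons /=.
under [in X in _ = X]eq_dsum => u v _ do rewrite dsum_cat_cons /=.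
under [in X in _ = _ + (X + _)]eq_dsum => u v _ do rewrite dsum_cat_cons /=.
rewrite scalerDr addrACA; congr (_ + _).
  rewrite -dsumZ -dsumD; apply: eq_dsum => u v _.
  rewrite scalerDr addrACA; congr (_ + _); rewrite -dsumZ -dsumD.
    apply: eq_dsum => p q _.
    have E z : map sg u ++ b p :: q ++ z :: s2 = (map sg u ++ b p :: q) ++ z :: s2.
      by rewrite -catA.
    by rewrite !E gl.
  by apply: eq_dsum => p q _; rewrite bl gl.
rewrite -dsumZ -dsumD; apply: eq_dsum => u v _.
rewrite -dsumZ -dsumD; apply: eq_dsum => p q _.
by rewrite !map_cat -!catA /= linearP gl.
Qed.

Hypothesis sgK : involutive sg.

Lemma map_sgK : involutive (map sg).
Proof. by move=> s; rewrite -map_comp (eq_map (g := id)) ?map_id. Qed.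

(** The square of an odd coderivation is again a coderivation. Insertions into two disjoint blocks
    occur in both orders with opposite signs, because [b] anticommutes with [sg], so only nested
    insertions survive; on the factors to their left the two signs cancel by [sgK]. *)
Lemma ins_ins (V : lmodType K) b (g : seq B -> V) s :
  multilinear g -> (forall t, b (map sg t) = - sg (b t)) ->
  ins b (ins b g) s =
  dsum (fun u => dsum (fun v w => g (u ++ ins b b v :: w))) s.
Proof.
move=> gl bsg.
have ins_slot p y q : ins b g (p ++ y :: q) =
    dsum (fun p1 => dsum (fun p2 p3 => g (map sg p1 ++ b p2 :: p3 ++ y :: q))) p
  + dsum (fun p1 p2 => dsum (fun q1 q2 =>
      g (map sg p1 ++ b (p2 ++ y :: q1) :: q2)) q) p
  + dsum (fun q1 => dsum (fun q2 q3 =>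
      g (map sg (p ++ y :: q1) ++ b q2 :: q3))) q.
  rewrite /ins dsum_cat_cons -dsumD; congr (_ + _).
  by apply: eq_dsum => u v _; rewrite dsum_cat_cons.
rewrite /ins -/(ins b b).
pose G u1 u2 u3 v w := g (u1 ++ sg (b u2) :: map sg u3 ++ b v :: w).
(* The second insertion takes place to the left of [b v], around it, or to its right. *)
transitivity (
   dsum (fun u => dsum (fun v w => dsum (fun u1 => dsum (fun u2 u3 =>
      - G u1 u2 u3 v w)) u)) s
 + dsum (fun u => dsum (fun v w => dsum (fun u1 u2 => dsum (fun w1 w2 =>
      g (u1 ++ b (map sg u2 ++ b v :: w1) :: w2)) w) u)) s
 + dsum (fun u => dsum (fun v w => dsum (fun w1 => dsum (fun w2 w3 =>
      G u v w1 w2 w3)) w)) s).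
  rewrite -!dsumD; apply: eq_dsum => u x _.
  rewrite -!dsumD; apply: eq_dsum => v w _.
  rewrite [LHS]ins_slot; congr (_ + _ + _).
  - rewrite dsum_map; apply: eq_dsum => u1 y _.
    rewrite dsum_map; apply: eq_dsum => u2 u3 _.
    by rewrite map_sgK bsg (multilinearN gl).
  - rewrite dsum_map; apply: eq_dsum => u1 y _.
    by apply: eq_dsum => w1 w2 _; rewrite map_sgK.
  apply: eq_dsum => w1 y _; apply: eq_dsum => w2 w3 _.
  by rewrite /G map_cat map_sgK -catA.
(* Both sums run over the cuts of [s] into five pieces whose second and fourth are arguments of [b];
   exchange and coassociativity bring them to the same order. *)
have -> : dsum (fun u => dsum (fun v w => dsum (fun u1 => dsum (fun u2 u3 =>
      - G u1 u2 u3 v w)) u)) s =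
    - dsum (fun u => dsum (fun v w => dsum (fun w1 => dsum (fun w2 w3 =>
      G u v w1 w2 w3)) w)) s.
  rewrite -dsumN.
  under eq_dsum => u x _ do rewrite dsum_exchange.
  rewrite dsum_assoc; apply: eq_dsum => u1 z _.
  under eq_dsum => y x _ do rewrite dsum_exchange.
  rewrite dsum_assoc -dsumN; apply: eq_dsum => u2 t _.
  rewrite -dsumN; apply: eq_dsum => u3 x _.
  by rewrite -dsumN; apply: eq_dsum => v w _.
rewrite addrAC addNr add0r.
under eq_dsum => u x _ do rewrite dsum_exchange.
rewrite dsum_assoc; apply: eq_dsum => u z _.
under [RHS]eq_dsum => y w _.
  rewrite (multilinear_dsum gl).
  under eq_dsum => a c _ do rewrite (multilinear_dsum gl).
  over.
rewrite dsum_assoc; apply: eq_dsum => a x _.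
by rewrite dsum_assoc.
Qed.

End Insertion.

(** * Graded spaces *)

Lemma big_seq_widen (V : nmodType) (s t : seq int) (c : int -> V) :
  uniq s -> uniq t -> {subset s <= t} -> (forall n, n \notin s -> c n = 0) ->
  \sum_(n <- t) c n = \sum_(n <- s) c n.
Proof.
move=> us ut st c0; rewrite [LHS](bigID (mem s)) /= [X in _ + X]big1 // addr0.
rewrite -big_filter; apply: perm_big.
apply: uniq_perm; rewrite ?filter_uniq // => n.
by rewrite mem_filter; case: (boolP (n \in s)) => //= /st.
Qed.

Section GradedSpace.
Variables (K : fieldType) (B : graded_space K).

Lemma gdeg0 n : gdeg n (0 : B).
Proof. by have [] := gdeg_submodule B n. Qed.

Lemma gdegD n (x y : B) : gdeg n x -> gdeg n y -> gdeg n (x + y).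
Proof. by move=> gx gy; rewrite -(scale1r x); apply: (gdeg_submodule B n).2. Qed.

Lemma gdegZ n a (x : B) : gdeg n x -> gdeg n (a *: x).
Proof.
by move=> gx; rewrite -[_ *: _]addr0; apply: (gdeg_submodule B n).2 => //; apply: gdeg0.
Qed.

Lemma gdegN n (x : B) : gdeg n x -> gdeg n (- x).
Proof. by rewrite -scaleN1r; apply: gdegZ. Qed.

Lemma gdeg_dsum T n (F : seq T -> seq T -> B) s :
  (forall u v, u ++ v = s -> gdeg n (F u v)) -> gdeg n (dsum F s).
Proof.
elim: s F => [|x s IHs] F gF /=; first exact: gF.
by apply: gdegD; [apply: gF | apply: IHs => u v uvs; apply: gF; rewrite /= uvs].
Qed.

(** Components are 0 off the chosen list, so sums over it extend to any larger list; this is how two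
    vectors get a common support. *)
Definition gdecomp (x : B) : {p : seq int * (int -> B) |
  [/\ uniq p.1, forall n, gdeg n (p.2 n), forall n, n \notin p.1 -> p.2 n = 0
    & x = \sum_(n <- p.1) p.2 n]}.
Proof.
apply: cid; have [s [c [us gc xE]]] := (gdeg_direct B).1 x.
exists (s, fun n => if n \in s then c n else 0); split=> //= [n|n /negPf-> //|].
  by case: ifP => // _; apply: gdeg0.
by rewrite xE; apply: eq_big_seq => n ->.
Qed.

Definition gsupp x := (sval (gdecomp x)).1.
Definition gproj n x := (sval (gdecomp x)).2 n.

Lemma gsupp_uniq x : uniq (gsupp x).
Proof. by rewrite /gsupp; case: (gdecomp x) => p []. Qed.

Lemma gproj_deg n x : gdeg n (gproj n x).
Proof. by rewrite /gproj; case: (gdecomp x) => p []. Qed.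

Lemma gproj_out n x : n \notin gsupp x -> gproj n x = 0.
Proof. by rewrite /gproj /gsupp; case: (gdecomp x) => p [] /= ? ? h ?; apply: h. Qed.

Lemma gproj_sum x : x = \sum_(n <- gsupp x) gproj n x.
Proof. by rewrite /gproj /gsupp; case: (gdecomp x) => p []. Qed.

Lemma gproj_unique s (c : int -> B) x :
  uniq s -> (forall n, gdeg n (c n)) -> (forall n, n \notin s -> c n = 0) ->
  x = \sum_(n <- s) c n -> forall n, gproj n x = c n.
Proof.
move=> us gc c0 xE n; pose r := undup (s ++ gsupp x).
have ur : uniq r by apply: undup_uniq.
have [|] := boolP (n \in r); last first.
  by rewrite mem_undup mem_cat negb_or => /andP[/c0-> /gproj_out].
move=> nr; apply/eqP; rewrite -subr_eq0; apply/eqP.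
have gd m : gdeg m (gproj m x - c m).
  by apply: gdegD; [apply: gproj_deg | apply: gdegN].
apply: ((gdeg_direct B).2 r _ ur gd) => //.
rewrite sumrB (big_seq_widen (gsupp_uniq x) ur).
- by rewrite -gproj_sum (big_seq_widen us ur) // => [|m ms];
    rewrite -?xE ?subrr // mem_undup mem_cat ms.
- by move=> m ms; rewrite mem_undup mem_cat ms orbT.
by move=> m; apply: gproj_out.
Qed.

Lemma gproj_linear n : linear (gproj n).
Proof.
move=> a x y; pose r := undup (gsupp x ++ gsupp y).
have ur : uniq r by apply: undup_uniq.
apply: (gproj_unique (c := fun n => a *: gproj n x + gproj n y) ur) => [m|m|].
- by apply: gdegD; [apply: gdegZ|]; apply: gproj_deg.
- rewrite mem_undup mem_cat negb_or => /andP[/gproj_out-> /gproj_out->].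
  by rewrite scaler0 addr0.
rewrite big_split -scaler_sumr /=.
rewrite (big_seq_widen (gsupp_uniq x) ur) ?(big_seq_widen (gsupp_uniq y) ur).
- by rewrite -!gproj_sum.
- by move=> m ms; rewrite mem_undup mem_cat ms orbT.
- by move=> m; apply: gproj_out.
- by move=> m ms; rewrite mem_undup mem_cat ms.
by move=> m; apply: gproj_out.
Qed.
HB.instance Definition _ n := GRing.isLinear.Build K B B _ (gproj n) (gproj_linear n).

Lemma gproj_id n x : gdeg n x -> gproj n x = x.
Proof.
move=> gx; rewrite (gproj_unique (s := [:: n]) (c := fun m => if m == n then x else 0)) ?eqxx //.
- by move=> m; case: eqP => [->//|_]; apply: gdeg0.
- by move=> m; rewrite inE => /negPf->.
by rewrite big_seq1 eqxx.
Qed.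

Lemma gproj_neq m n x : gdeg n x -> m != n -> gproj m x = 0.
Proof.
move=> gx mn; rewrite (gproj_unique (s := [:: n]) (c := fun m => if m == n then x else 0));
  rewrite ?(negPf mn) //.
- by move=> k; case: eqP => [->//|_]; apply: gdeg0.
- by move=> k; rewrite inE => /negPf->.
by rewrite big_seq1 eqxx.
Qed.

(** Reduces additive identities to homogeneous arguments, where the axioms involving degrees
    apply. *)
Lemma homogeneous_ind (P : B -> Prop) :
  (forall x y, P x -> P y -> P (x + y)) ->
  (forall n x, gdeg n x -> P x) -> forall x, P x.
Proof.
move=> PD Ph x; rewrite (gproj_sum x); apply: big_ind => //.
  by apply: (Ph 0); apply: gdeg0.
by move=> n _; apply: (Ph n); apply: gproj_deg.
Qed.

Section DirectSumMap.
Variables (V : lmodType K) (g : int -> {linear B -> V}).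

Definition gsum x := \sum_(n <- gsupp x) g n (gproj n x).

Lemma gsum_widen s x : uniq s -> {subset gsupp x <= s} ->
  gsum x = \sum_(n <- s) g n (gproj n x).
Proof.
move=> us xs; rewrite (big_seq_widen (gsupp_uniq x) us) // => n /gproj_out->.
exact: linear0.
Qed.

Lemma gsum_linear : linear gsum.
Proof.
move=> a x y; pose r := undup (gsupp (a *: x + y) ++ gsupp x ++ gsupp y).
have sr z t : {subset z <= gsupp (a *: x + y) ++ gsupp x ++ gsupp y} -> t = r ->
  {subset z <= t} by move=> zs -> m /zs; rewrite mem_undup.
rewrite !(@gsum_widen r) ?undup_uniq //; try by apply: sr => // m ms; rewrite !mem_cat ms ?orbT.
rewrite scaler_sumr -big_split; apply: eq_bigr => n _ /=.
by rewrite !linearP.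
Qed.
HB.instance Definition _ := GRing.isLinear.Build K B V _ gsum gsum_linear.

Lemma gsum_deg n x : gdeg n x -> gsum x = g n x.
Proof.
move=> gx; rewrite (@gsum_widen (undup (n :: gsupp x))) ?undup_uniq; last 2 first.
- by [].
- by move=> m ms; rewrite mem_undup inE ms orbT.
rewrite (big_seq_widen (s := [:: n])) ?undup_uniq //.
- by rewrite big_seq1 gproj_id.
- by move=> m; rewrite inE mem_undup => /eqP->; apply: mem_head.
by move=> m; rewrite inE => /(gproj_neq gx)->; apply: linear0.
Qed.

End DirectSumMap.

(** Encoding signs as a linear operator makes sense on all elements, so the recursive construction
    and its identities can be stated for arbitrary lists. *)
Definition gpar : B -> B := gsum (fun n => (-1) ^ n \*: idfun).
HB.instance Definition _ := GRing.Linear.on gpar.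

Lemma gpar_deg n x : gdeg n x -> gpar x = (-1) ^ n *: x.
Proof. exact: gsum_deg. Qed.

Lemma gdeg_gpar n x : gdeg n x -> gdeg n (gpar x).
Proof. by move=> gx; rewrite (gpar_deg gx); apply: gdegZ. Qed.

(** The parity operator of the shifted space, in which degree n becomes n - 1. *)
Definition koszul : B -> B := \- gpar.
HB.instance Definition _ := GRing.Linear.on koszul.

Lemma koszulE x : koszul x = - gpar x. Proof. by []. Qed.

Lemma gdeg_koszul n x : gdeg n x -> gdeg n (koszul x).
Proof. by move=> gx; apply/gdegN/gdeg_gpar. Qed.

End GradedSpace.

(** Giving half the difference of the exponents as [c] turns each comparison of signs into a ring
    identity over the integers. *)
Lemma signz_cong (R : unitRingType) (m n c : int) :
  m - n = c * 2 -> (-1 : R) ^ m = (-1) ^ n.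
Proof.
move=> mn; rewrite -[m](subrK n) mn exprzDr ?unitrN1 // mulrC -exprz_exp.
by rewrite [(-1) ^ 2]sqrrN expr1n exp1rz mul1r.
Qed.

Section GradedMaps.
Variables (K : fieldType) (B C : graded_space K) (h : {linear B -> C}).
Variable p : int.
Hypothesis hp : forall n x, gdeg n x -> gdeg (n + p) (h x).

Lemma gpar_map x : gpar (h x) = (-1) ^ p *: h (gpar x).
Proof.
elim/homogeneous_ind: x => [x y Px Py|n x gx]; first by rewrite !linearD /= Px Py.
rewrite (gpar_deg (hp gx)) (gpar_deg gx) linearZ /= scalerA.
by rewrite -exprzDr ?unitrN1 // addrC.
Qed.

Lemma koszul_map x : koszul (h x) = (-1) ^ p *: h (koszul x).
Proof. by rewrite !koszulE gpar_map linearN scalerN. Qed.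

Lemma gproj_map n x : h (gproj n x) = gproj (n + p) (h x).
Proof.
elim/homogeneous_ind: x => [x y Px Py|m x gx]; first by rewrite !linearD /= Px Py.
have [->|nm] := eqVneq n m; first by rewrite !gproj_id //; apply: hp.
rewrite (gproj_neq gx nm) linear0 (gproj_neq (hp gx)) //.
by rewrite (inj_eq (addIr p)).
Qed.

End GradedMaps.

Lemma gpar_involutive (K : fieldType) (B : graded_space K) : involutive (@gpar K B).
Proof.
move=> x; elim/homogeneous_ind: x => [x y Px Py|n x gx]; first by rewrite !linearD /= Px Py.
rewrite (gpar_deg (gdeg_gpar gx)) (gpar_deg gx) scalerA -exprzDr ?unitrN1 //.
by rewrite (@signz_cong _ _ 0 n) ?expr0z ?scale1r //; ring.
Qed.

Lemma koszul_involutive (K : fieldType) (B : graded_space K) :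
  involutive (@koszul K B).
Proof. by move=> x; rewrite !koszulE linearN opprK; apply: gpar_involutive. Qed.

Section DgaSigns.
Variables (K : fieldType) (A : dga K).

Lemma gpar_wedge (x y : A) : gpar (wedge A x y) = wedge A (gpar x) (gpar y).
Proof.
elim/homogeneous_ind: x => [x x' Px Px'|m x gx].
  by rewrite !(linearDl, linearD) /= Px Px'.
elim/homogeneous_ind: y => [y y' Py Py'|n y gy].
  by rewrite !linearD /= Py Py'.
rewrite (gpar_deg (wedge_deg gx gy)) (gpar_deg gx) (gpar_deg gy).
by rewrite linearZl_LR linearZr_LR scalerA -exprzDr ?unitrN1.
Qed.

Lemma dif_wedge_gpar (x y : A) :
  dif A (wedge A x y) = wedge A (dif A x) y + wedge A (gpar x) (dif A y).
Proof.
elim/homogeneous_ind: x => [x x' Px Px'|m x gx].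
  by rewrite !(linearDl, linearD) /= Px Px' addrACA.
by rewrite (dif_wedge _ gx) (gpar_deg gx) linearZl_LR.
Qed.

Lemma gpar_dif (x : A) : gpar (dif A x) = - dif A (gpar x).
Proof. by rewrite (gpar_map (@dif_deg _ A)) expr1z scaleN1r. Qed.

End DgaSigns.

(** * The recursive construction *)

Section DeconcatenationBoundary.
Variables (T : Type) (V : nmodType).

Lemma dsum_first (F : seq T -> seq T -> V) s :
  (forall u v, u ++ v = s -> u <> [::] -> F u v = 0) -> dsum F s = F [::] s.
Proof.
case: s => [|x s] F0 //=; rewrite dsum0 ?addr0 // => u v uvs.
by apply: F0 => //=; rewrite uvs.
Qed.

Lemma dsum_last (F : seq T -> seq T -> V) s :
  (forall u v, u ++ v = s -> v <> [::] -> F u v = 0) -> dsum F s = F s [::].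
Proof.
elim: s F => [|x s IHs] F F0 //=.
by rewrite F0 // add0r IHs // => u v uvs; apply: F0; rewrite /= uvs.
Qed.

Lemma dsum3_whole (F : seq T -> seq T -> seq T -> V) s :
  (forall u v w, u ++ v ++ w = s -> (size v < size s)%N -> F u v w = 0) ->
  dsum (fun u => dsum (F u)) s = F [::] s [::].
Proof.
move=> F0; rewrite dsum_first => [|u x uxs u0].
  apply: dsum_last => v w vws w0; apply: (F0 [::]) => //.
  by rewrite -vws size_cat; case: w w0 {vws} => //= y w _; rewrite addnS ltnS leq_addr.
apply: dsum0 => v w vwx; apply: F0; first by rewrite vwx.
rewrite -uxs -vwx !size_cat; case: u u0 {uxs} => //= y u _.
by rewrite addSn ltnS addnCA leq_addr.
Qed.

End DeconcatenationBoundary.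

Section Convolution.
Variables (K : fieldType) (H : graded_space K) (A : dga K).

(** The quadratic term of the morphism relations. The [gpar] on the left factor is the sign that
    makes [wedge] an operation of degree 1 on the shifted algebra. *)
Definition conv (f : seq H -> A) (s : seq H) : A :=
  dsum (fun u v => wedge A (gpar (f u)) (f v)) s.

Lemma conv_multilinear f : multilinear f -> multilinear (conv f).
Proof.
move=> fl s1 s2 a x y; rewrite /conv !dsum_cat_cons scalerDr addrACA.
congr (_ + _); rewrite -dsumZ -dsumD; apply: eq_dsum => u v _.
  by rewrite fl linearPr.
by rewrite fl linearP linearPl.
Qed.

(** Both sides are the sum of the triple products over s = u v w with [gpar] on the middle factor
    only: on the left, the outer [gpar] cancels the one on the first factor and creates one on the
    second. *)
Lemma conv_assoc f s :
  dsum (fun u v => wedge A (gpar (conv f u)) (f v)) s =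
  dsum (fun u v => wedge A (f u) (conv f v)) s.
Proof.
transitivity (dsum (fun x w => dsum (fun u v =>
    wedge A (wedge A (f u) (gpar (f v))) (f w)) x) s).
  apply: eq_dsum => x w _; rewrite /conv raddf_dsum /= -[LHS]/(applyr (wedge A) (f w) _).
  rewrite raddf_dsum; apply: eq_dsum => u v _ /=.
  by rewrite gpar_wedge gpar_involutive.
rewrite dsum_assoc; apply: eq_dsum => u x _.
rewrite /conv raddf_dsum; apply: eq_dsum => v w _.
by rewrite /= wedgeA.
Qed.

End Convolution.

Section Transfer.
Variables (K : fieldType) (H : graded_space K) (A : dga K).
Variables (i : {linear H -> A}) (cl : {linear A -> H}) (Q : {linear A -> A}).
Local Notation ins := (ins (@koszul K H)).

(* Only the values of b and f on lists shorter than s enter. *)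
Definition obstruction (b : seq H -> H) (f : seq H -> A) (s : seq H) : A :=
  let f' t := if (size t < size s)%N then f t else 0 in
  let b' t := if (1 < size t < size s)%N then b t else 0 in
  conv f' s - ins b' f' s.

(** The fuel [n] bounds the length, since the recursive calls are on lists that are not subterms of
    [s]. The short case encodes b_1 = 0 and f_1 = i; on the empty list the default of [head] gives i
    0 = 0. *)
Fixpoint transfer (n : nat) (s : seq H) : H * A :=
  if n is n'.+1 then
    if (size s <= 1)%N then (0, i (head 0 s)) else
      let o := obstruction (fun t => (transfer n' t).1)
                           (fun t => (transfer n' t).2) s in
      (cl o, Q (i (cl o) - o))
  else (0, 0).

Definition transfer_op (s : seq H) : H := (transfer (size s) s).1.
Definition transfer_map (s : seq H) : A := (transfer (size s) s).2.

Lemma eq_obstruction b b' f f' s :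
  (forall t, size t < size s -> b t = b' t)%N ->
  (forall t, size t < size s -> f t = f' t)%N ->
  obstruction b f s = obstruction b' f' s.
Proof.
move=> bb ff; rewrite /obstruction.
have -> : (fun t => if (size t < size s)%N then f t else 0) =
          (fun t => if (size t < size s)%N then f' t else 0).
  by apply: funext => t; case: ifP => // /ff.
suff -> : (fun t => if (1 < size t < size s)%N then b t else 0) =
          (fun t => if (1 < size t < size s)%N then b' t else 0) by [].
by apply: funext => t; case: ifP => // /andP[_ /bb].
Qed.

(** The masks in [obstruction] discard every list that is not shorter than [s], so fuel beyond the
    length changes nothing. *)
Lemma transfer_stable n s : (size s <= n)%N -> transfer n s = transfer (size s) s.
Proof.
elim: n {-2}n (leqnn n) s => [|N IHN] [|n] //; try by move=> _ [].
rewrite ltnS => nN [|x s] sn; first by rewrite /= linear0.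
rewrite [size (x :: s)]/=; simpl; case: ifP => // _.
suff -> : obstruction (fun t => (transfer n t).1) (fun t => (transfer n t).2)
    (x :: s) = obstruction (fun t => (transfer (size s) t).1)
    (fun t => (transfer (size s) t).2) (x :: s) by [].
have st t : (size t < size (x :: s))%N -> transfer n t = transfer (size s) t.
  by move: sn => /= sn ts; rewrite IHN ?[RHS]IHN //; lia.
by apply: eq_obstruction => t /st->.
Qed.

Lemma transfer_map0 : transfer_map [::] = 0. Proof. by []. Qed.
Lemma transfer_map1 x : transfer_map [:: x] = i x. Proof. by []. Qed.

Local Notation obs := (obstruction transfer_op transfer_map).

Lemma transferE s : (1 < size s)%N ->
  transfer (size s) s = (cl (obs s), Q (i (cl (obs s)) - obs s)).
Proof.
case: s => // x s s1; rewrite [size (x :: s)]/=; simpl; rewrite leqNgt s1.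
suff -> : obstruction (fun t => (transfer (size s) t).1)
    (fun t => (transfer (size s) t).2) (x :: s) = obs (x :: s) by [].
by apply: eq_obstruction => t ts; rewrite transfer_stable.
Qed.

Lemma transfer_opE s : (1 < size s)%N -> transfer_op s = cl (obs s).
Proof. by move=> s1; rewrite {1}/transfer_op transferE. Qed.

Lemma transfer_mapE s : (1 < size s)%N ->
  transfer_map s = Q (i (cl (obs s)) - obs s).
Proof. by move=> s1; rewrite {1}/transfer_map transferE. Qed.

Lemma mask_multilinear (V : lmodType K) (P : pred nat) (g : seq H -> V) :
  multilinear g -> multilinear (fun t => if P (size t) then g t else 0).
Proof.
move=> gl s1 s2 a x y; rewrite !size_cat /=; case: ifP => _; first exact: gl.
by rewrite scaler0 addr0.
Qed.

Lemma obstruction_multilinear b f :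
  multilinear b -> multilinear f -> multilinear (obstruction b f).
Proof.
move=> bl fl s1 s2 a x y; rewrite /obstruction !size_cat /=.
set n := (_ + _)%N; set f' := fun t => _; set b' := fun t => _.
have fl' : multilinear f' by apply: (@mask_multilinear _ (fun k => k < n)%N).
have bl' : multilinear b' by apply: (@mask_multilinear _ (fun k => 1 < k < n)%N).
rewrite conv_multilinear // ins_multilinear //.
by rewrite scalerBr addrACA opprD.
Qed.

Lemma transfer_multilinear n :
  multilinear (fun t => (transfer n t).1) /\
  multilinear (fun t => (transfer n t).2).
Proof.
elim: n => [|n [bl fl]]; first by split=> s1 s2 a x y; rewrite scaler0 addr0.
have ol := obstruction_multilinear bl fl.
split=> s1 s2 a x y /=; rewrite !size_cat /=; case: ifP => s12.
- by rewrite scaler0 addr0.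
- by rewrite ol linearP.
- by case: s1 s12 => [_|? s1 /=]; [rewrite linearP | lia].
rewrite ol; move: (obstruction _ _ (_ ++ x :: _)) (obstruction _ _ (_ ++ y :: _)).
move=> ox oy; rewrite -(linearP Q); congr (Q _).
by rewrite (linearP cl) (linearP i) scalerBr opprD addrACA.
Qed.

Lemma transfer_op_multilinear : multilinear transfer_op.
Proof.
move=> s1 s2 a x y; have [h _] := transfer_multilinear (size (s1 ++ x :: s2)).
have := h s1 s2 a x y.
by rewrite /transfer_op !size_cat.
Qed.

Lemma transfer_map_multilinear : multilinear transfer_map.
Proof.
move=> s1 s2 a x y; have [_ h] := transfer_multilinear (size (s1 ++ x :: s2)).
have := h s1 s2 a x y.
by rewrite /transfer_map !size_cat.
Qed.

(** Removes the masks. Products with an empty piece vanish because f is 0 on the empty list; in the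
    insertion sum the mask loses only the block equal to [s], which is the last term added back. *)
Lemma obstructionE s : (1 < size s)%N ->
  obs s = conv transfer_map s - ins transfer_op transfer_map s
          + transfer_map [:: transfer_op s].
Proof.
move=> s1; rewrite /obstruction -addrA; set f' := fun t => _; set b' := fun t => _.
have [bl fl] := (transfer_op_multilinear, transfer_map_multilinear).
congr (_ + _).
  have f'0 : f' [::] = 0 by rewrite /f' if_same.
  apply: eq_dsum => u v uvs.
  case: u uvs => [|x u]; first by rewrite f'0 transfer_map0 linear0 !linear0l.
  case: v => [|y v uvs]; first by rewrite f'0 transfer_map0 !linear0r.
  rewrite /f' -uvs size_cat.
  by rewrite !ifT //= !(addSn, addnS) !ltnS ?leq_addr // leq_addl.
apply: (addrI (ins transfer_op transfer_map s)); rewrite addrA subrr add0r.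
rewrite !insE -dsumN -dsumD.
under eq_dsum => u x _ do rewrite -dsumN -dsumD.
rewrite dsum3_whole /= => [|u v w uvws vs].
  rewrite /b' ltnn andbF /f' /= s1 [X in _ - X](_ : _ = 0) ?subr0 //.
  exact: (multilinear0 fl [::]).
rewrite /b' vs andbT; case: ifP => [v1|].
  rewrite /f' ifT ?subrr // -uvws !size_cat /= size_map.
  by rewrite ltn_add2l -[X in (X < _)%N]add1n ltn_add2r.
move=> /negbT; rewrite -leqNgt => v1; rewrite /f'.
(* Blocks of length at most 1 contribute nothing even without the mask, as [transfer_op] vanishes on
   them. *)
have -> : transfer_op v = 0 by case: v v1 {uvws vs} => [|y []].
by rewrite (multilinear0 fl) if_same subr0.
Qed.

End Transfer.

(** * Naturality and degrees *)

Section Naturality.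
Variables (K : fieldType) (H H' : graded_space K) (A A' : dga K).
Variables (i : {linear H -> A}) (cl : {linear A -> H}) (Q : {linear A -> A}).
Variables (i' : {linear H' -> A'}) (cl' : {linear A' -> H'}).
Variables (Q' : {linear A' -> A'}).
Variables (phiA : {linear A -> A'}) (phiH : {linear H -> H'}) (eps : K).
Hypothesis eps2 : eps * eps = 1.
Hypothesis phiA_gpar : forall x, phiA (gpar x) = gpar (phiA x).
Hypothesis phiH_gpar : forall x, phiH (gpar x) = gpar (phiH x).
Hypothesis phiA_wedge : forall x y,
  phiA (wedge A x y) = eps *: wedge A' (phiA x) (phiA y).
Hypothesis phiA_Q : forall x, phiA (Q x) = eps *: Q' (phiA x).
Hypothesis phiA_i : forall u, phiA (i u) = i' (phiH u).
Hypothesis phiH_cl : forall x, phiH (cl x) = cl' (phiA x).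

Lemma obstruction_natural b f b' f' s : multilinear f' ->
  (forall t, phiH (b t) = eps *: b' (map phiH t)) ->
  (forall t, phiA (f t) = f' (map phiH t)) ->
  phiA (obstruction b f s) = eps *: obstruction b' f' (map phiH s).
Proof.
move=> fl' bb ff; rewrite /obstruction linearB scalerBr size_map; congr (_ - _).
  rewrite /conv raddf_dsum dsum_map -dsumZ; apply: eq_dsum => u v _ /=.
  by rewrite !size_map phiA_wedge phiA_gpar; do 2!case: ifP => _;
    rewrite ?ff // linear0.
rewrite /ins raddf_dsum dsum_map -dsumZ; apply: eq_dsum => u x _ /=.
rewrite raddf_dsum dsum_map -dsumZ; apply: eq_dsum => v w _ /=.
rewrite !size_cat /= !size_map; case: (_ < _)%N; last by rewrite linear0 scaler0.
rewrite ff map_cat /= -!map_comp.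
have -> : map (phiH \o @koszul K H) u = map (@koszul K H' \o phiH) u.
  by apply: eq_map => y; rewrite /= !koszulE linearN phiH_gpar.
case: ifP => _; last by rewrite linear0 (multilinear0 fl') scaler0.
by rewrite bb (multilinearZ fl').
Qed.

(** Used with [eps] = 1 for isometries, and with [eps] = -1 and both maps equal to [koszul] for the
    sign rule of the construction. The product and the homotopy each contribute one [eps]: one
    remains on the operations, two cancel on the map. *)
Lemma transfer_natural n s :
  phiH (transfer i cl Q n s).1 = eps *: (transfer i' cl' Q' n (map phiH s)).1 /\
  phiA (transfer i cl Q n s).2 = (transfer i' cl' Q' n (map phiH s)).2.
Proof.
elim: n s => [|n IHn] s /=; first by rewrite !linear0.
rewrite size_map; case: ifP => _ /=.
  by rewrite linear0 scaler0 phiA_i; case: s => [|x s] //=; rewrite linear0.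
have [_ fl'] := transfer_multilinear i' cl' Q' n.
have oE := obstruction_natural (b' := fun t => (transfer i' cl' Q' n t).1)
  s fl' (fun t => (IHn t).1) (fun t => (IHn t).2).
split; first by rewrite phiH_cl oE linearZ.
rewrite phiA_Q linearB phiA_i phiH_cl oE; move: (obstruction _ _ _) => o.
by rewrite (linearZ_LR cl') (linearZ_LR i') -scalerBr (linearZ_LR Q') scalerA eps2 scale1r.
Qed.

Lemma transfer_op_natural s :
  phiH (transfer_op i cl Q s) = eps *: transfer_op i' cl' Q' (map phiH s).
Proof. by rewrite /transfer_op (transfer_natural _ s).1 size_map. Qed.

Lemma transfer_map_natural s :
  phiA (transfer_map i cl Q s) = transfer_map i' cl' Q' (map phiH s).
Proof. by rewrite /transfer_map (transfer_natural _ s).2 size_map. Qed.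

End Naturality.

Section Homogeneous.
Variables (K : fieldType) (B : graded_space K).
Implicit Types (e : seq int) (u v : seq B).

Lemma homogeneous_size e u : homogeneous e u -> size e = size u.
Proof. by elim: e u => [|n e IHe] [|x u] //= [_ /IHe->]. Qed.

Lemma homogeneous_cat e1 e2 u v :
  homogeneous e1 u -> homogeneous e2 v -> homogeneous (e1 ++ e2) (u ++ v).
Proof. by elim: e1 u => [|n e IHe] [|x u] //= [gx eu] ev; split=> //; apply: IHe. Qed.

Lemma homogeneous_catP e u v : homogeneous e (u ++ v) ->
  exists e1 e2, [/\ e = e1 ++ e2, homogeneous e1 u & homogeneous e2 v].
Proof.
elim: u e => [|x u IHu] e /=; first by exists [::], e.
case: e => //= n e [gx /IHu[e1 [e2 [-> ? ?]]]].
by exists (n :: e1), e2.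
Qed.

Lemma homogeneous_koszul e u : homogeneous e u -> homogeneous e (map (@koszul K B) u).
Proof.
by elim: e u => [|n e IHe] [|x u] //= [gx /IHe eu]; split=> //; apply: gdeg_koszul.
Qed.

(* Unlike [has_degree], this also constrains the value on the empty list. *)
Definition degree_on_lists (V : graded_space K) (p : int) (g : seq B -> V) :=
  forall e s, homogeneous e s -> gdeg (\sum_(n <- e) n + (p - (size s)%:Z)) (g s).

Lemma mask_degree (V : graded_space K) p (P : pred nat) (g : seq B -> V) :
  degree_on_lists p g ->
  degree_on_lists p (fun t => if P (size t) then g t else 0).
Proof. by move=> gd e s es; case: ifP => _; [apply: gd | apply: gdeg0]. Qed.

Lemma conv_degree (A : dga K) (f : seq B -> A) :
  degree_on_lists 1 f -> degree_on_lists 2 (conv f).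
Proof.
move=> fd e s es; apply: gdeg_dsum => u v uvs; move: es; rewrite -uvs.
move=> /homogeneous_catP[e1 [e2 [-> /fd eu /fd ev]]].
have := wedge_deg (gdeg_gpar eu) ev; congr gdeg.
by rewrite big_cat size_cat PoszD /=; ring.
Qed.

Lemma ins_degree (V : graded_space K) p b (g : seq B -> V) :
  degree_on_lists 2 b -> degree_on_lists p g ->
  degree_on_lists (p + 1) (ins (@koszul K B) b g).
Proof.
move=> bd gd e s es; apply: gdeg_dsum => u x uxs; move: es; rewrite -uxs.
move=> /homogeneous_catP[e1 [e' [-> eu ex]]].
apply: gdeg_dsum => v w vwx; move: ex; rewrite -vwx.
move=> /homogeneous_catP[e2 [e3 [-> ev ew]]].
have ebw : homogeneous (\sum_(n <- e2) n + (2 - (size v)%:Z) :: e3) (b v :: w).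
  by split=> //; apply: bd.
have := gd _ _ (homogeneous_cat (homogeneous_koszul eu) ebw); congr gdeg.
rewrite !big_cat big_cons !size_cat /= size_map !PoszD (intS (size w)).
by ring.
Qed.

End Homogeneous.

Section TransferDegree.
Variables (K : fieldType) (H : graded_space K) (A : dga K).
Variables (i : {linear H -> A}) (cl : {linear A -> H}) (Q : {linear A -> A}).
Hypothesis i_deg : forall n u, gdeg n u -> gdeg n (i u).
Hypothesis cl_deg : forall n x, gdeg n x -> gdeg n (cl x).
Hypothesis Q_deg : forall n x, gdeg n x -> gdeg (n - 1) (Q x).

Lemma transfer_degree n :
  degree_on_lists 2 (fun t => (transfer i cl Q n t).1) /\
  degree_on_lists 1 (fun t => (transfer i cl Q n t).2).
Proof.
elim: n => [|n [bd fd]]; first by split=> e s _; apply: gdeg0.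
have od : degree_on_lists 2 (obstruction (fun t => (transfer i cl Q n t).1)
                                         (fun t => (transfer i cl Q n t).2)).
  move=> e s es; rewrite /obstruction; set f' := fun t : seq H => _.
  set b' := fun t : seq H => _.
  have fd' : degree_on_lists 1 f' by apply: (@mask_degree _ _ _ _ (fun k => k < size s)%N).
  have bd' : degree_on_lists 2 b'.
    by apply: (@mask_degree _ _ _ _ (fun k => 1 < k < size s)%N).
  by apply: gdegD; [|apply: gdegN]; [apply: conv_degree | apply: (ins_degree bd' fd')].
split=> e s es /=; case: ifP => s1; first exact: gdeg0.
- exact/cl_deg/od.
- case: e s es s1 => [|d e] [|x s] //= => [_ _|[gx]]; first by rewrite linear0; apply: gdeg0.
  case: e s => [|d' e] [|x' s] //= _ _.
  by rewrite big_seq1 subrr addr0; apply: i_deg.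
have := Q_deg (gdegD (i_deg (cl_deg (od _ _ es))) (gdegN (od _ _ es))).
by congr gdeg; ring.
Qed.

Lemma transfer_op_degree : has_degree 2 (transfer_op i cl Q).
Proof. by move=> e s _ es; apply: (transfer_degree (size s)).1. Qed.

Lemma transfer_map_degree : has_degree 1 (transfer_map i cl Q).
Proof. by move=> e s _ es; apply: (transfer_degree (size s)).2. Qed.

End TransferDegree.

(** * The A-infinity relations *)

(** The inserted block lies in the left or in the right factor of the product. In the second case
    the left factor carries both [koszul] and [gpar], whose composite is -1. *)
Lemma ins_conv (K : fieldType) (H : graded_space K) (A : dga K)
    (b : seq H -> H) (f : seq H -> A) s :
  (forall t, f (map (@koszul K H) t) = koszul (f t)) ->
  ins (@koszul K H) b (conv f) s =
  dsum (fun u v => wedge A (gpar (ins (@koszul K H) b f u)) (f v)) s -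
  dsum (fun u v => wedge A (f u) (ins (@koszul K H) b f v)) s.
Proof.
move=> fk.
transitivity (
   - dsum (fun u => dsum (fun v w => dsum (fun p q =>
       wedge A (f p) (f (map (@koszul K H) q ++ b v :: w))) u)) s
 + dsum (fun u => dsum (fun v w => dsum (fun p q =>
       wedge A (gpar (f (map (@koszul K H) u ++ b v :: p))) (f q)) w)) s).
  rewrite -dsumN -dsumD; apply: eq_dsum => u x _.
  rewrite -dsumN -dsumD; apply: eq_dsum => v w _.
  rewrite /conv dsum_cat_cons dsum_map -dsumN; congr (_ + _).
  by apply: eq_dsum => p q _; rewrite fk koszulE linearN /= gpar_involutive linearNl.
rewrite [LHS]addrC; congr (_ - _).
  have E y w : wedge A (gpar (ins (@koszul K H) b f y)) (f w) =
      dsum (fun u => dsum (fun v p =>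
        wedge A (gpar (f (map (@koszul K H) u ++ b v :: p))) (f w))) y.
    rewrite /ins raddf_dsum /= -[LHS]/(applyr (wedge A) (f w) _) raddf_dsum.
    apply: eq_dsum => u z _ /=; rewrite raddf_dsum /=.
    by rewrite -[LHS]/(applyr (wedge A) (f w) _) raddf_dsum.
  under [RHS]eq_dsum => y w _ do rewrite E.
  rewrite dsum_assoc; apply: eq_dsum => u t _.
  by rewrite dsum_assoc.
under eq_dsum => u x _ do rewrite dsum_exchange.
rewrite dsum_assoc; apply: eq_dsum => p z _.
rewrite /ins raddf_dsum; apply: eq_dsum => q x _ /=.
by rewrite raddf_dsum.
Qed.

Section TransferRelations.
Variables (K : fieldType) (H : graded_space K) (A : dga K).
Variables (i : {linear H -> A}) (cl : {linear A -> H}) (Q : {linear A -> A}).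
Hypothesis i_deg : forall n u, gdeg n u -> gdeg n (i u).
Hypothesis cl_deg : forall n x, gdeg n x -> gdeg n (cl x).
Hypothesis Q_deg : forall n x, gdeg n x -> gdeg (n - 1) (Q x).
Hypothesis dif_i : forall u, dif A (i u) = 0.
Hypothesis cl_i : forall u, cl (i u) = u.
Hypothesis cl_dif : forall x, cl (dif A x) = 0.
Hypothesis dif_Q : forall x, dif A x = 0 ->
  dif A (Q (i (cl x) - x)) = i (cl x) - x.
Local Notation ins := (ins (@koszul K H)).
Local Notation b := (transfer_op i cl Q).
Local Notation f := (transfer_map i cl Q).
Let bl := transfer_op_multilinear i cl Q.
Let fl := transfer_map_multilinear i cl Q.

(** Naturality applied to [koszul] itself: it commutes with i and cl, which have degree 0, and picks
    up -1 on the product and on Q, which has degree -1. *)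
Lemma transfer_koszul s :
  koszul (b s) = - b (map (@koszul K H) s) /\
  koszul (f s) = f (map (@koszul K H) s).
Proof.
have kg (B : graded_space K) (x : B) : koszul (gpar x) = gpar (koszul x).
  by rewrite !koszulE linearN.
have kw (x y : A) : koszul (wedge A x y) = (-1) *: wedge A (koszul x) (koszul y).
  by rewrite !koszulE gpar_wedge linearNl linearNr opprK scaleN1r.
have kQ x : koszul (Q x) = (-1) *: Q (koszul x).
  by rewrite (koszul_map Q_deg) exprN1 invrN1.
have ki u : koszul (i u) = i (koszul u).
  by rewrite (@koszul_map _ _ _ i 0) ?expr0z ?scale1r // => n x; rewrite addr0; apply: i_deg.
have kc x : koszul (cl x) = cl (koszul x).
  by rewrite (@koszul_map _ _ _ cl 0) ?expr0z ?scale1r // => n y; rewrite addr0; apply: cl_deg.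
have N1 : (-1 : K) * (-1) = 1 by rewrite mulrNN mulr1.
split; last exact: (transfer_map_natural N1 (kg A) (kg H) kw kQ ki kc).
by rewrite -scaleN1r; apply: (transfer_op_natural N1 (kg A) (kg H) kw kQ ki kc).
Qed.

Lemma transfer_op_le1 s : (size s <= 1)%N -> b s = 0.
Proof. by case: s => [|x []]. Qed.

Lemma ins_transfer_le1 (V : lmodType K) (g : seq H -> V) s :
  multilinear g -> (size s <= 1)%N -> ins b g s = 0.
Proof.
move=> gl s1; apply: dsum0 => u x uxs; apply: dsum0 => v w vwx.
rewrite transfer_op_le1 ?(multilinear0 gl) //; apply: leq_trans s1.
by rewrite -uxs -vwx !size_cat addnCA leq_addr.
Qed.

Lemma conv_transfer_le1 s : (size s <= 1)%N -> conv f s = 0.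
Proof.
move=> s1; apply: dsum0 => -[|x u] v uvs.
  by rewrite transfer_map0 linear0 linear0l.
case: v uvs => [|y v] uvs; first by rewrite transfer_map0 linear0r.
by move: s1; rewrite -uvs /= size_cat /=; lia.
Qed.

(** The equation of an A-infinity morphism in shifted degrees; [twist] converts it to the signed
    form in [ainf_morphism]. *)
Definition morphism_relation s := ins b f s = dif A (f s) + conv f s.

(** By the Leibniz rule d falls on one factor, where the relation replaces d f by [ins b f] minus
    [conv f]. The cubic terms cancel by [conv_assoc], and [ins_conv] reassembles the rest. *)
Lemma dif_conv s :
  (forall t, (size t < size s)%N -> morphism_relation t) ->
  dif A (conv f s) = - ins b (conv f) s.
Proof.
move=> IH; rewrite ins_conv; last by move=> t; rewrite (transfer_koszul t).2.
rewrite opprB addrC -[RHS]addr0.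
(* Adds the difference of the two sides of [conv_assoc], so that the cubic terms can be cancelled
   cut by cut. *)
rewrite -[X in _ + X](subrr (dsum (fun u v => wedge A (f u) (conv f v)) s)).
rewrite -[X in _ + (X - _)]conv_assoc addrACA -!dsumN -!dsumD /conv raddf_dsum.
apply: eq_dsum => u v uvs; rewrite /= dif_wedge_gpar gpar_involutive.
have -> : dif A (gpar (f u)) = - gpar (dif A (f u)) by rewrite gpar_dif opprK.
rewrite -/(conv f u) -/(conv f v).
(* When one piece is empty the other is all of [s], out of reach of [IH]; then every term vanishes
   because f and the sums are 0 on the empty list. *)
case: v uvs => [|x v] uvs.
  rewrite transfer_map0 !linear0r ins_transfer_le1 // conv_transfer_le1 // !linear0r.
  by rewrite linear0 linear0r !(oppr0, addr0).
case: u uvs => [|y u] uvs.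
  rewrite transfer_map0 !linear0 !linear0l ins_transfer_le1 // conv_transfer_le1 //.
  by rewrite !(oppr0, addr0, linear0, linear0l).
rewrite !IH -?uvs ?size_cat //=; try by lia.
by rewrite linearD linearDl linearDr linearNl opprD addrNK addrK.
Qed.

(** Replacing d f by [ins b f] minus [conv f] inside the insertion yields the square of the
    coderivation. By [ins_ins] it inserts b o b, which vanishes on shorter lists, so only the whole
    of [s] contributes. *)
Lemma dif_ins s :
  (forall t, (size t < size s)%N -> morphism_relation t) ->
  (forall t, (size t < size s)%N -> ins b b t = 0) ->
  dif A (ins b f s) = f [:: ins b b s] - ins b (conv f) s.
Proof.
move=> IHf IHb.
have <- : ins b (ins b f) s = f [:: ins b b s].
  rewrite ins_ins //; first last.
  - by move=> t /=; rewrite (transfer_koszul t).1 opprK.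
  - exact: koszul_involutive.
  apply: dsum3_whole => u v w _ /IHb->; exact: multilinear0.
rewrite ![ins b _ s]insE -dsumN -dsumD raddf_dsum; apply: eq_dsum => u x uxs /=.
rewrite -dsumN -dsumD raddf_dsum; apply: eq_dsum => v w vwx /=.
(* A block of length at least 2 shortens the list, so [IHf] applies; for shorter blocks b is 0. *)
have [v1|v1] := leqP (size v) 1.
  rewrite transfer_op_le1 // (multilinear0 fl) (multilinear0 (ins_multilinear _ bl fl)).
  by rewrite (multilinear0 (conv_multilinear fl)) linear0 subr0.
rewrite IHf ?addrK // -uxs -vwx !size_cat /= size_map.
by rewrite ltn_add2l -[X in (X < _)%N]add1n ltn_add2r.
Qed.

Lemma transfer_relations s : morphism_relation s /\ ins b b s = 0.
Proof.
elim: {s}(size s) {-2}s (leqnn (size s)) => [|n IHn] s sn.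
  have s1 : (size s <= 1)%N by apply: leq_trans sn _.
  split; last exact: ins_transfer_le1.
  rewrite /morphism_relation ins_transfer_le1 // conv_transfer_le1 //.
  by case: s {s1} sn => //= _; rewrite transfer_map0 linear0 addr0.
have [s1|s1] := leqP (size s) 1.
  split; last exact: ins_transfer_le1.
  rewrite /morphism_relation ins_transfer_le1 // conv_transfer_le1 //.
  case: s s1 {sn} => [|x [|]] //= _; first by rewrite transfer_map0 linear0 addr0.
  by rewrite transfer_map1 dif_i addr0.
have IHs t : (size t < size s)%N -> morphism_relation t /\ ins b b t = 0.
  by move=> ts; apply: IHn; rewrite -ltnS; apply: leq_trans sn.
have IHf t ts := (IHs t ts).1; have IHb t ts := (IHs t ts).2.
have oE := obstructionE i cl Q s1; set o := obstruction _ _ s in oE.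
have dif_o : dif A o = - i (ins b b s).
  rewrite oE !linearD linearN dif_conv // dif_ins // transfer_map1 dif_i addr0.
  by rewrite transfer_map1 opprB addrA addNr add0r.
(* Applying cl to [dif_o] kills the exact side and leaves b o b up to sign. *)
have bb0 : ins b b s = 0.
  by rewrite -[LHS]cl_i -[i _]opprK -dif_o -linearN cl_dif.
(* Now o is closed, so [dif_Q] gives d (f s) = i (b s) - o; substituting [oE] for o is the relation
   at [s]. *)
split=> //; rewrite /morphism_relation transfer_mapE // -/o dif_Q; last first.
  by rewrite dif_o bb0 linear0 oppr0.
rewrite -(transfer_opE i cl Q s1) oE transfer_map1.
by rewrite opprD opprB [i _ + _]addrC subrK subrK.
Qed.

End TransferRelations.

(** * Signs *)

Section Twist.
Variables (K : fieldType) (B : graded_space K).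

(* Multiplies s by (-1)^(sum of deg s_i * (number of entries after s_i)), the
   sign relating operations of degree 2 - k to their shifts of degree 1. *)
Fixpoint twist (s : seq B) : seq B :=
  if s is x :: s' then iter (size s') (@gpar K B) x :: twist s' else [::].

Fixpoint twist_exp (e : seq int) : int :=
  if e is n :: e' then n * (size e')%:Z + twist_exp e' else 0.

Lemma twist_exp_cat e1 e2 :
  twist_exp (e1 ++ e2) =
  twist_exp e1 + (\sum_(n <- e1) n) * (size e2)%:Z + twist_exp e2.
Proof.
elim: e1 => [|n e1 IHe] /=; first by rewrite big_nil; ring.
by rewrite IHe big_cons size_cat PoszD; ring.
Qed.

Lemma size_twist s : size (twist s) = size s.
Proof. by elim: s => //= x s ->. Qed.

Lemma gdeg_iter_gpar k n (x : B) : gdeg n x -> gdeg n (iter k (@gpar K B) x).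
Proof. by move=> gx; elim: k => //= k; apply: gdeg_gpar. Qed.

Lemma iter_gpar_deg k n (x : B) : gdeg n x ->
  iter k (@gpar K B) x = (-1) ^ (n * k%:Z) *: x.
Proof.
move=> gx; elim: k => [|k IHk]; first by rewrite mulr0 expr0z scale1r.
rewrite iterS (gpar_deg (gdeg_iter_gpar k gx)) IHk scalerA -exprzDr ?unitrN1 //.
by congr (_ ^ _ *: _); rewrite intS; ring.
Qed.

Lemma homogeneous_twist e s : homogeneous e s -> homogeneous e (twist s).
Proof.
by elim: e s => [|n e IHe] [|x s] //= [gx /IHe es]; split=> //; apply: gdeg_iter_gpar.
Qed.

Lemma twist_multilinear (V : lmodType K) (h : seq B -> V) :
  multilinear h -> multilinear (h \o twist).
Proof.
move=> hl s1 s2 a x y.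
have [u uE] : exists u, forall z, twist (s1 ++ z :: s2) =
    u ++ iter (size s2) (@gpar K B) z :: twist s2.
  elim: s1 => [|z s1 [u uE]]; first by exists [::].
  exists (iter (size (s1 ++ z :: s2)) (@gpar K B) z :: u) => z'.
  by rewrite /= uE !size_cat.
rewrite /= !uE -hl; congr (h (_ ++ _ :: _)).
by elim: (size s2) => //= k ->; rewrite linearP.
Qed.

Lemma map_koszul_sign (V : lmodType K) (h : seq B -> V) e u w :
  multilinear h -> homogeneous e u ->
  h (map (@koszul K B) u ++ w) =
  (-1) ^ ((size u)%:Z + \sum_(n <- e) n) *: h (u ++ w).
Proof.
(* The prefix [p] collects the entries whose sign has already been extracted. *)
move=> hl; suff gen p : homogeneous e u -> h (p ++ map (@koszul K B) u ++ w) =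
    (-1) ^ ((size u)%:Z + \sum_(n <- e) n) *: h (p ++ u ++ w) by apply: (gen [::]).
elim: u e p => [|x u IHu] [|n e] p //=.
  by rewrite big_nil addr0 expr0z scale1r.
case=> gx eu; rewrite koszulE (gpar_deg gx) -scaleNr (multilinearZ hl).
rewrite -cat_rcons (IHu e) // scalerA cat_rcons; congr (_ *: _).
rewrite -mulN1r -[X in X * _ * _]expr1z -!exprzDr ?unitrN1 //; congr (_ ^ _).
by rewrite big_cons intS; ring.
Qed.

Lemma twist_sign (V : lmodType K) (h : seq B -> V) e s :
  multilinear h -> homogeneous e s -> h (twist s) = (-1) ^ twist_exp e *: h s.
Proof.
move=> hl; suff gen p : homogeneous e s ->
  h (p ++ twist s) = (-1) ^ twist_exp e *: h (p ++ s) by apply: (gen [::]).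
elim: s e p => [|x s IHs] [|n e] p //=; first by rewrite expr0z scale1r.
case=> gx es; rewrite (iter_gpar_deg _ gx) (multilinearZ hl) -cat_rcons (IHs e) //.
rewrite cat_rcons scalerA -exprzDr ?unitrN1 //.
by rewrite (homogeneous_size es).
Qed.

End Twist.

Section Signs.
Variables (K : fieldType) (B : graded_space K) (b : seq B -> B).
Hypotheses (bl : multilinear b) (bd : has_degree 2 b) (b0 : b [::] = 0).

(** Empty blocks drop out because [b] is 0 on the empty list, which matches the ranges r < size s
    and l >= 1. *)
Lemma ins_big (V : lmodType K) (g : seq B -> V) s : multilinear g ->
  ins (@koszul K B) b g s =
  \sum_(r < size s) \sum_(1 <= l < (size s - r).+1)
    g (map (@koszul K B) (take r s) ++ b (take l (drop r s)) :: drop (r + l) s).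
Proof.
move=> gl; rewrite insE dsum_big big_ord_recr /= drop_size /= b0 (multilinear0 gl) addr0.
apply: eq_bigr => r _; rewrite dsum_big big_ord_recl take0 b0 (multilinear0 gl) add0r.
rewrite big_add1 big_mkord /= size_drop; apply: eq_bigr => l _.
by rewrite drop_drop addnC.
Qed.

(** Termwise comparison: the Stasheff sign, the twist of the inner block and the twist of the
    contracted list together have the parity of the twist of [s] plus the [koszul] signs on the
    first r factors. *)
Lemma insertion_sum_twist (V : lmodType K) (g : seq B -> V) e s :
  multilinear g -> homogeneous e s ->
  insertion_sum (g \o @twist K B) (b \o @twist K B) e s =
  (-1) ^ twist_exp e *: ins (@koszul K B) b g s.
Proof.
move=> gl es; rewrite ins_big // scaler_sumr; apply: eq_bigr => r _.
rewrite scaler_sumr big_nat_cond [RHS]big_nat_cond; apply: eq_bigr => l.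
rewrite andbT => /andP[l0 lr].
have -> : drop (r + l) s = drop l (drop r s) by rewrite drop_drop addnC.
have rs := ltn_ord r.
have se := homogeneous_size es.
set u := take r s; set v := take l (drop r s); set w := drop l (drop r s).
have sE : s = u ++ v ++ w by rewrite !cat_take_drop.
have su : size u = r by rewrite size_takel // ltnW.
have sv : size v = l by rewrite size_takel // size_drop; lia.
have sw : size w = (size s - r - l)%N by rewrite !size_drop.
move: (es); rewrite {1}sE => /homogeneous_catP[e1 [e23 [eE eu]]].
move=> /homogeneous_catP[e2 [e3 [e23E ev ew]]]; rewrite {}e23E in eE.
have -> : take r e = e1 by rewrite eE take_size_cat // (homogeneous_size eu).
have v0 : v != [::] by rewrite -size_eq0 sv -lt0n.
have dv := bd v0 ev.
pose e' := e1 ++ (\sum_(n <- e2) n + (2 - (size v)%:Z)) :: e3.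
rewrite /= (twist_sign bl ev) (twist_sign gl (e := e')); last first.
  by apply: homogeneous_cat => //; split=> //; apply: gdegZ.
rewrite (multilinearZ gl) (map_koszul_sign _ gl eu) !scalerA -!exprzDr ?unitrN1 //.
congr (_ *: _); rewrite -sw eE /e' !twist_exp_cat /= size_cat.
rewrite (homogeneous_size ev) (homogeneous_size ew) su sv.
(* Half the difference of the two total exponents; the twists internal to the three blocks
   cancel. *)
apply: (@signz_cong _ _ _ ((\sum_(n <- e1) n) * (1 - l%:Z) + (size w)%:Z)).
by rewrite !PoszD PoszM (intS (size w)); ring.
Qed.

(** The cuts at both ends vanish since [f] is 0 on the empty list. For the others, [gpar] on the
    first factor, of degree 1 - k plus the degrees in [u], accounts for the remaining sign. *)
Lemma conv_twist (A : dga K) (f : seq B -> A) e s :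
  multilinear f -> has_degree 1 f -> f [::] = 0 -> s != [::] ->
  homogeneous e s ->
  \sum_(1 <= k < size s)
    (-1) ^ (k.-1%:Z + (1 - (size s - k)%N%:Z) * \sum_(n <- take k e) n) *:
    wedge A ((f \o @twist K B) (take k s)) ((f \o @twist K B) (drop k s)) =
  (-1) ^ twist_exp e *: conv f s.
Proof.
move=> fl fd f0 s0 es; rewrite /conv dsum_big big_ord_recr /= drop_size f0 linear0r addr0.
rewrite -(big_mkord xpredT (fun k => wedge A (gpar (f (take k s))) (f (drop k s)))).
rewrite [X in _ = _ *: X]big_ltn ?lt0n ?size_eq0 // take0 f0 linear0 linear0l add0r.
rewrite scaler_sumr big_nat_cond [RHS]big_nat_cond; apply: eq_bigr => k.
rewrite andbT => /andP[k0 ks].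
set u := take k s; set v := drop k s.
have sE : s = u ++ v by rewrite cat_take_drop.
have su : size u = k by rewrite size_takel // ltnW.
have sv : size v = (size s - k)%N by rewrite size_drop.
have se := homogeneous_size es.
move: (es); rewrite {1}sE => /homogeneous_catP[e1 [e2 [eE eu ev]]].
have -> : take k e = e1 by rewrite eE take_size_cat // (homogeneous_size eu).
have u0 : u != [::] by rewrite -size_eq0 su -lt0n.
rewrite (twist_sign fl eu) (twist_sign fl ev) (gpar_deg (fd _ _ u0 eu)).
rewrite !linearZl_LR !linearZr_LR !scalerA -!exprzDr ?unitrN1 //.
congr (_ *: _); rewrite -sv eE twist_exp_cat (homogeneous_size ev) su.
apply: (@signz_cong _ _ _ (k%:Z - 1 - (\sum_(n <- e1) n) * (size v)%:Z)).
by rewrite -[X in k.-1%:Z + X]addr0 -(subrr 1) predn_int //; ring.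
Qed.

End Signs.

(** * The transferred structure and its morphism *)

Section TransferredStructure.
Variables (K : fieldType) (H : graded_space K) (A : dga K).
Variables (i : {linear H -> A}) (cl : {linear A -> H}) (Q : {linear A -> A}).
Hypothesis i_deg : forall n u, gdeg n u -> gdeg n (i u).
Hypothesis cl_deg : forall n x, gdeg n x -> gdeg n (cl x).
Hypothesis Q_deg : forall n x, gdeg n x -> gdeg (n - 1) (Q x).
Hypothesis dif_i : forall u, dif A (i u) = 0.
Hypothesis cl_i : forall u, cl (i u) = u.
Hypothesis cl_dif : forall x, cl (dif A x) = 0.
Hypothesis dif_Q : forall x, dif A x = 0 ->
  dif A (Q (i (cl x) - x)) = i (cl x) - x.
Local Notation b := (transfer_op i cl Q).
Local Notation f := (transfer_map i cl Q).
Local Notation twist := (@twist K H).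
Let bl := transfer_op_multilinear i cl Q.
Let fl := transfer_map_multilinear i cl Q.
Let bd := transfer_op_degree i_deg cl_deg Q_deg.
Let fd := transfer_map_degree i_deg cl_deg Q_deg.
Let rel := transfer_relations i_deg cl_deg Q_deg dif_i cl_i cl_dif dif_Q.

Lemma twist_degree (V : graded_space K) p (g : seq H -> V) :
  has_degree p g -> has_degree p (g \o twist).
Proof.
move=> gd e s s0 es; rewrite -(size_twist s); apply: gd.
  by rewrite -size_eq0 size_twist size_eq0.
exact: homogeneous_twist.
Qed.

Fact transfer_stasheff e s : s != [::] -> homogeneous e s ->
  insertion_sum (b \o twist) (b \o twist) e s = 0.
Proof. by move=> _ es; rewrite insertion_sum_twist // (rel s).2 scaler0. Qed.

Definition transfer_ainf : ainf_structure H :=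
  AInf (twist_multilinear bl) (twist_degree bd) transfer_stasheff.

Lemma transfer_ainf_morphism : ainf_morphism transfer_ainf (f \o twist).
Proof.
split; [exact: twist_multilinear | exact: twist_degree |].
move=> e s s0 es; rewrite [LHS]insertion_sum_twist // conv_twist // (rel s).1.
by rewrite /= (twist_sign fl es) linearZ -scalerDr.
Qed.

Lemma transfer_ainf2 u v :
  transfer_ainf [:: u; v] = cl (wedge A (i u) (i v)).
Proof.
have obs2 x y : obstruction b f [:: x; y] = wedge A (gpar (i x)) (i y).
  rewrite /obstruction [X in _ - X]dsum0 => [|p q _]; last first.
    apply: dsum0 => v' w _; case: ifP => // _; case: ifP => [/andP[/= ? ?]|_]; first by lia.
    exact: multilinear0.
  by rewrite subr0 /conv /= !(linear0, linear0l, linear0r) add0r addr0.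
(* [twist] puts a [gpar] on [u], which cancels the one from [conv]. *)
rewrite [LHS]transfer_opE // obs2 (@gpar_map _ _ _ i 0) => [|n x gx].
  by rewrite expr0z scale1r gpar_involutive.
by rewrite addr0; apply: i_deg.
Qed.

End TransferredStructure.

(** * The homotopy of a Hodge decomposition *)

Section HodgeHomotopy.
Variables (K : numFieldType) (theta : K -> K) (A : hodge_dga theta).
Local Notation d := (dif A).
Local Notation ds := (codif A).
Local Notation form := (@metric K theta A).

Lemma metric_eq0 (x : A) : form x x = 0 -> x = 0.
Proof.
move=> x0; apply/eqP; apply: contraT => /(neq0_dnorm_gt0 (s := form)).
by rewrite x0 ltxx.
Qed.

Lemma metric_ge0 (x : A) : 0 <= form x x.
Proof.
have [->|x0] := eqVneq x 0; first by rewrite linear0l.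
exact/ltW/(neq0_dnorm_gt0 (s := form)).
Qed.

Lemma metric_sym (x y : A) : form x y = theta (form y x).
Proof. by rewrite (hermitian_subproof (s := form)) expr0 mul1r. Qed.

(** Pairing the Laplacian of h with h gives the sum of the squared norms of d^* h and d h, so both
    vanish. *)
Lemma harmonic_closed h : d (ds h) + ds (d h) = 0 -> d h = 0.
Proof.
move=> h0; apply: metric_eq0.
have : form (d (ds h) + ds (d h)) h = 0 by rewrite h0 linear0l.
have -> : form (d (ds h) + ds (d h)) h = form (d (ds h)) h + form (ds (d h)) h.
  exact: linearDl.
have -> : form (ds (d h)) h = form (d h) (d h).
  by rewrite metric_sym -metric_adjoint -metric_sym.
rewrite metric_adjoint.
by move/eqP; rewrite paddr_eq0 ?metric_ge0 // => /andP[_ /eqP].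
Qed.

Lemma codif_dif_eq0 c : d (ds c) = 0 -> ds c = 0.
Proof. by move=> c0; apply: metric_eq0; rewrite -metric_adjoint c0 linear0l. Qed.

(* q is the d^*-exact primitive of the d-exact part of a. *)
Definition primitive (a q : A) : Prop := exists e h c,
  [/\ q = ds e, d (ds h) + ds (d h) = 0 & a = h + d q + ds c].

Lemma primitive_total a : exists q, primitive a q.
Proof.
have [h [b [c [hh ->]]]] := (hodge_decomp A).1 a.
(* Decomposing the primitive [b] once more, d sees only its d^*-exact part, as harmonic elements are
   closed. *)
have [h' [b' [e [hh' ->]]]] := (hodge_decomp A).1 b.
exists (ds e), e, h, c; split=> //.
by rewrite !linearD (harmonic_closed hh') dif_dif !add0r.
Qed.

(** The relation is linear; with [primitive0] this makes it the graph of a linear map. *)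
Lemma primitiveP t a q a' q' :
  primitive a q -> primitive a' q' -> primitive (t *: a + a') (t *: q + q').
Proof.
move=> [e [h [c [-> hh ->]]]] [e' [h' [c' [-> hh' ->]]]].
exists (t *: e + e'), (t *: h + h'), (t *: c + c'); split.
- by rewrite linearP.
- by rewrite !(linearP d, linearP ds) /= addrACA -scalerDr hh hh' scaler0 addr0.
by rewrite !(linearP d, linearP ds) /= !scalerDr addrACA [X in X + _]addrACA.
Qed.

Lemma primitive0 q : primitive 0 q -> q = 0.
Proof.
move=> [e [h [c [-> hh /esym a0]]]]; apply: codif_dif_eq0.
by have [] := (hodge_decomp A).2 _ _ _ hh a0.
Qed.

Lemma primitive_unique a q q' : primitive a q -> primitive a q' -> q = q'.
Proof.
move=> aq aq'; have := primitiveP (-1) aq aq'.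
rewrite !scaleN1r addNr => /primitive0/eqP.
by rewrite addrC subr_eq0 => /eqP.
Qed.

Definition hodge_primitive a : A := sval (cid (primitive_total a)).

Lemma hodge_primitiveP a : primitive a (hodge_primitive a).
Proof. exact: (svalP (cid (primitive_total a))). Qed.

Lemma hodge_primitive_linear : linear hodge_primitive.
Proof.
move=> t a a'; apply: primitive_unique (hodge_primitiveP _) _.
by apply: primitiveP; apply: hodge_primitiveP.
Qed.
HB.instance Definition _ :=
  GRing.isLinear.Build K A A _ hodge_primitive hodge_primitive_linear.

Lemma dif_hodge_primitive x : d (hodge_primitive (d x)) = d x.
Proof.
have [e [h [c [_ hh dxE]]]] := hodge_primitiveP (d x).
(* Compares the decomposition of [d x] found by [hodge_primitive] with the trivial one. *)
have : h + d (hodge_primitive (d x) - x) + ds c = 0.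
  by rewrite linearB /= addrA [LHS]addrAC -dxE subrr.
move=> dx0; have [_ + _] := (hodge_decomp A).2 _ _ _ hh dx0.
by rewrite linearB => /eqP; rewrite subr_eq0 => /eqP.
Qed.

(* The component of degree -1: the metric is not assumed to make the degrees
   orthogonal, so d^* need not be homogeneous. *)
Definition hodge_homotopy : A -> A :=
  gsum (fun n => gproj (n - 1) \o hodge_primitive).
HB.instance Definition _ := GRing.Linear.on hodge_homotopy.

Lemma hodge_homotopy_deg n x :
  gdeg n x -> hodge_homotopy x = gproj (n - 1) (hodge_primitive x).
Proof. exact: gsum_deg. Qed.

Lemma gdeg_hodge_homotopy n x : gdeg n x -> gdeg (n - 1) (hodge_homotopy x).
Proof. by move=> gx; rewrite (hodge_homotopy_deg gx); apply: gproj_deg. Qed.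

(** Projecting the primitive to one degree is harmless: d is homogeneous, so it carries that
    component to the component of [d x], which is all of [d x]. *)
Lemma dif_hodge_homotopy x : d (hodge_homotopy (d x)) = d x.
Proof.
elim/homogeneous_ind: x => [x y Px Py|n x gx]; first by rewrite !linearD /= Px Py.
rewrite (hodge_homotopy_deg (dif_deg gx)) addrK (gproj_map (@dif_deg _ A)).
by rewrite dif_hodge_primitive gproj_id //; apply: dif_deg.
Qed.

Local Notation Q := hodge_homotopy.
Local Notation H := (cohomology A).

(** Changing the chosen representative by an exact element does not change the result, because d Q d
    = d; hence the section is linear. *)
Definition hodge_repr (u : H) : A := coh_repr u - d (Q (coh_repr u)).
(** [coh_class] takes a junk value off the closed elements and is not linear on A. Subtracting
    [Q (d x)] makes the argument closed, which extends the class map linearly to all of A. *)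
Definition hodge_class (x : A) : H := coh_class (x - Q (d x)).

Lemma hodge_repr_class x : d x = 0 -> hodge_repr (coh_class x) = x - d (Q x).
Proof.
move=> dx; have [b xb] := coh_repr_class dx.
rewrite /hodge_repr -(subrK x (coh_repr _)) xb !linearD /= dif_hodge_homotopy.
by rewrite addrACA subrr add0r.
Qed.

Lemma closed_sub_homotopy x : d (x - Q (d x)) = 0.
Proof. by rewrite linearB /= dif_hodge_homotopy subrr. Qed.

Lemma hodge_class_closed x : d x = 0 -> hodge_class x = coh_class x.
Proof. by move=> dx; rewrite /hodge_class dx !linear0 addr0. Qed.

Lemma hodge_class_dif x : hodge_class (d x) = 0.
Proof.
by rewrite hodge_class_closed ?dif_dif //; apply: (coh_class_exact (b := x)) => //; apply: dif_dif.
Qed.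

Lemma dif_hodge_repr u : d (hodge_repr u) = 0.
Proof. by rewrite linearB /= coh_repr_closed dif_dif subr0. Qed.

Lemma coh_class_hodge_repr u : coh_class (hodge_repr u) = u.
Proof.
rewrite -[RHS]coh_reprK; apply/(coh_class_eq (dif_hodge_repr u) (coh_repr_closed u)).
by exists (- Q (coh_repr u)); rewrite /hodge_repr addrAC subrr add0r linearN.
Qed.

Lemma hodge_repr_linear : linear hodge_repr.
Proof.
move=> a u v; rewrite -{1}(coh_reprK u) -{1}(coh_reprK v).
have [du dv] := (coh_repr_closed u, coh_repr_closed v).
rewrite -(coh_classP a du dv) hodge_repr_class; last first.
  by rewrite linearP /= du dv scaler0 addr0.
by rewrite /hodge_repr !linearP /= scalerBr scalerN addrACA.
Qed.
HB.instance Definition _ := GRing.isLinear.Build K H A _ hodge_repr hodge_repr_linear.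

Lemma hodge_class_linear : linear hodge_class.
Proof.
move=> a x y; rewrite /hodge_class.
rewrite -(coh_classP a (closed_sub_homotopy x) (closed_sub_homotopy y)).
by congr coh_class; rewrite !linearP /= scalerBr scalerN addrACA.
Qed.
HB.instance Definition _ := GRing.isLinear.Build K A H _ hodge_class hodge_class_linear.

Lemma gdeg_sub_difK n x : gdeg n x -> gdeg n (x - d (Q x)).
Proof.
move=> gx; apply: gdegD => //; apply: gdegN.
by rewrite -(subrK 1 n); apply: dif_deg; apply: gdeg_hodge_homotopy.
Qed.

Lemma gdeg_hodge_repr n u : gdeg n u -> gdeg n (hodge_repr u).
Proof. by case=> x [dx gx ->]; rewrite hodge_repr_class //; apply: gdeg_sub_difK. Qed.

Lemma gdeg_hodge_class n x : gdeg n x -> gdeg n (hodge_class x).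
Proof.
move=> gx; exists (x - Q (d x)); split=> //; first exact: closed_sub_homotopy.
apply: gdegD => //; apply: gdegN.
by rewrite -(addrK 1 n); apply: gdeg_hodge_homotopy; apply: dif_deg.
Qed.

Lemma hodge_class_repr u : hodge_class (hodge_repr u) = u.
Proof. by rewrite hodge_class_closed ?dif_hodge_repr // coh_class_hodge_repr. Qed.

Lemma dif_homotopy_error x : d x = 0 ->
  d (Q (hodge_repr (hodge_class x) - x)) = hodge_repr (hodge_class x) - x.
Proof.
move=> dx; rewrite hodge_class_closed // hodge_repr_class // addrAC subrr add0r.
by rewrite -linearN /= dif_hodge_homotopy.
Qed.

Definition hodge_ainf : ainf_structure H :=
  transfer_ainf gdeg_hodge_repr gdeg_hodge_class gdeg_hodge_homotopy
    dif_hodge_repr hodge_class_repr hodge_class_dif dif_homotopy_error.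

Lemma hodge_ainf2 (u v : coh A) : hodge_ainf [:: u; v] = coh_mul u v.
Proof.
rewrite [LHS]transfer_ainf2 /=.
rewrite -[in RHS](coh_class_hodge_repr u) -[in RHS](coh_class_hodge_repr v).
have [du dv] := (dif_hodge_repr u, dif_hodge_repr v).
by rewrite coh_mulE // hodge_class_closed // wedge_closed.
Qed.

End HodgeHomotopy.

(** * Naturality under isometric isomorphisms *)

Section HodgeNaturality.
Variables (K : numFieldType) (theta : K -> K) (A B : hodge_dga theta).
Variable phi : hodge_iso A B.

(** Adjoints are unique: by surjectivity the difference [z] is [phi] of some element, and moving d
    across both metrics shows that [z] is orthogonal to itself. *)
Lemma hodge_iso_codif x : phi (codif A x) = codif B (phi x).
Proof.
have [psi psiK phiK] := hodge_bij phi.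
apply/eqP; rewrite -subr_eq0; apply/eqP; set z := _ - _.
apply: (@metric_eq0 _ _ B); rewrite -{1}(phiK z).
have -> w : metric B (phi w) z =
    metric B (phi w) (phi (codif A x)) - metric B (phi w) (codif B (phi x)).
  exact: linearBr.
by rewrite -metric_adjoint -hodge_fun_dif !hodge_fun_metric metric_adjoint subrr.
Qed.

(** The choice made by [cid] does not matter, since [phi] preserves the relation [primitive] and its
    solution is unique. *)
Lemma hodge_iso_primitive a : phi (hodge_primitive a) = hodge_primitive (phi a).
Proof.
apply: primitive_unique (hodge_primitiveP _); have [e [h [c [-> hh]]]] := hodge_primitiveP a.
move=> /(congr1 phi) ->.
exists (phi e), (phi h), (phi c); rewrite -!(hodge_iso_codif, hodge_fun_dif) -!linearD hh.
by rewrite linear0.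
Qed.

Lemma hodge_iso_homotopy x : phi (hodge_homotopy x) = hodge_homotopy (phi x).
Proof.
elim/homogeneous_ind: x => [x y Px Py|n x gx]; first by rewrite !linearD /= Px Py.
have phi0 m y : gdeg m y -> gdeg (m + 0) (phi y) by rewrite addr0; apply: hodge_fun_deg.
rewrite (hodge_homotopy_deg gx) (hodge_homotopy_deg (hodge_fun_deg phi gx)).
by rewrite (gproj_map phi0) addr0 hodge_iso_primitive.
Qed.

Lemma dif_hodge_iso x : dif A x = 0 -> dif B (phi x) = 0.
Proof. by move=> dx; rewrite -hodge_fun_dif dx linear0. Qed.

Definition cohomology_map : cohomology A -> cohomology B := coh_map phi.

Lemma cohomology_map_linear : linear cohomology_map.
Proof.
move=> a u v; rewrite /cohomology_map -(coh_reprK u) -(coh_reprK v).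
have [du dv] := (coh_repr_closed u, coh_repr_closed v).
rewrite -(coh_classP a du dv) !coh_mapE //; last first.
  by rewrite linearP /= du dv scaler0 addr0.
by rewrite linearP; apply: coh_classP; apply: dif_hodge_iso.
Qed.
HB.instance Definition _ := GRing.isLinear.Build K (cohomology A) (cohomology B) _
  cohomology_map cohomology_map_linear.

Lemma cohomology_map_gpar u : cohomology_map (gpar u) = gpar (cohomology_map u).
Proof.
rewrite (@gpar_map _ _ _ cohomology_map 0) ?expr0z ?scale1r // => n _ [x [dx gx ->]].
rewrite addr0; exists (phi x); split; [exact: dif_hodge_iso | exact: hodge_fun_deg |].
exact: coh_mapE.
Qed.

Lemma hodge_iso_gpar x : phi (gpar x) = gpar (phi x).
Proof.
rewrite (@gpar_map _ _ _ phi 0) ?expr0z ?scale1r // => n y gy.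
by rewrite addr0; apply: hodge_fun_deg.
Qed.

Lemma hodge_iso_repr u : phi (hodge_repr u) = hodge_repr (cohomology_map u).
Proof.
rewrite -(coh_reprK u) /cohomology_map; have du := coh_repr_closed u.
rewrite coh_mapE // !hodge_repr_class //; last exact: dif_hodge_iso.
by rewrite linearB /= hodge_fun_dif hodge_iso_homotopy.
Qed.

Lemma hodge_iso_class x : cohomology_map (hodge_class x) = hodge_class (phi x).
Proof.
rewrite /cohomology_map /hodge_class coh_mapE ?closed_sub_homotopy //.
by rewrite linearB /= hodge_iso_homotopy hodge_fun_dif.
Qed.

Lemma hodge_ainf_natural (s : seq (cohomology A)) :
  cohomology_map (hodge_ainf A s) = hodge_ainf B (map cohomology_map s).
Proof.
(* Moves [twist] inside the map, which commutes with [gpar]; the factor 1 is the [eps] of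
   [transfer_op_natural]. *)
have -> : hodge_ainf B (map cohomology_map s) =
    1 *: transfer_op (@hodge_repr _ _ B) (@hodge_class _ _ B) (@hodge_homotopy _ _ B)
      (map cohomology_map (twist s)).
  rewrite scale1r; congr transfer_op; elim: s => //= x s ->.
  rewrite size_map; congr (_ :: _).
  by elim: (size s) => //= k ->; rewrite cohomology_map_gpar.
apply: (transfer_op_natural (mul1r 1) hodge_iso_gpar cohomology_map_gpar) => [x y|x||].
- by rewrite scale1r hodge_fun_wedge.
- by rewrite scale1r hodge_iso_homotopy.
- exact: hodge_iso_repr.
- exact: hodge_iso_class.
Qed.

End HodgeNaturality.

Theorem theorem2p2 (R : realType) (k : metric_kind) :
  exists m : forall A : hodge_dga (scalar_conj R k),
      ainf_structure (cohomology A),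
    canonical m /\
    forall (A : hodge_dga (scalar_conj R k)) (u v : coh A),
      m A [:: u; v] = coh_mul u v.
Proof.
exists (@hodge_ainf _ _); split; last exact: hodge_ainf2.
split=> [A B phi s _|A]; first exact/esym/(hodge_ainf_natural phi).
exists (transfer_map (@hodge_repr _ _ A) (@hodge_class _ _ A) (@hodge_homotopy _ _ A)
  \o @twist _ _); split; first exact: transfer_ainf_morphism.
(* On a single entry [twist] is the identity, so f_1 is [hodge_repr]. *)
by move=> u; split; [exact: dif_hodge_repr | exact: coh_class_hodge_repr].
Qed.
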